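(* Let $\Omega\subset\mathbb{R}^N$ be a bounded domain, let $\mathcal{K}$ be either $\mathcal{K}^+_{k_1,\dots,k_\ell}$ or $\mathcal{K}^-_{k_1,\dots,k_\ell}$, and let $c,f\in C(\Omega)$ be such that $$\|c^+\|_{\infty}<\sum_{i=1}^\ell C_{k_i,s}\,\frac{1}{2s}\,(\mathrm{diam}(\Omega))^{-2s}.$$ If $u\in USC(\overline\Omega)\cap L^\infty(\mathbb{R}^N)$ and $v\in LSC(\overline\Omega)\cap L^\infty(\mathbb{R}^N)$ are respectively a (viscosity) subsolution and a (viscosity) supersolution of $$\mathcal{K}w+c(x)w=f(x)\ \text{ in }\Omega,\qquad w=0\ \text{ in }\mathbb{R}^N\setminus\Omega,$$ then $u\le v$ in $\Omega$.
   Context: Fix $N\in\mathbb{N}$, $s\in(0,1)$, $1\le\ell\le N$ and integers $1\le k_1\le\dots\le k_\ell\le N$ with $k:=\sum_{j=1}^\ell k_j\le N$. Here $c^+=\max\{c,0\}$. For an $n$-dimensional linear subspace $V\subset\mathbb{R}^N$, $$\mathcal{J}_Vu(x)=C_{n,s}\,P.V.\int_V\frac{u(x+z)-u(x)}{|z|^{n+2s}}\,d\mathcal{H}^n(z),$$ where $\mathcal{H}^n$ is the $n$-dimensional Hausdorff measure and $C_{n,s}>0$ is a normalizing constant depending only on $n,s$. For $u\in L^\infty(\mathbb{R}^N)\cap C^2(\Omega)$ and $x\in\Omega$, $\mathcal{K}^+_{k_1,\dots,k_\ell}u(x)$ (resp. $\mathcal{K}^-_{k_1,\dots,k_\ell}u(x)$)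 is the supremum (resp. infimum) of $\sum_{i=1}^\ell\mathcal{J}_{V_i}u(x)$ over all families $(V_1,\dots,V_\ell)$ of pairwise orthogonal linear subspaces of $\mathbb{R}^N$ with $\dim V_i=k_i$. Viscosity solutions: let $g\in C(\Omega\times\mathbb{R})$. A function $u\in L^\infty(\mathbb{R}^N)\cap LSC(\Omega)$ (resp. $USC(\Omega)$) is a supersolution (resp. subsolution) of $\mathcal{K}^{+}_{k_1,\dots,k_\ell}u+g(x,u(x))=0$ in $\Omega$ if for every $x_0\in\Omega$ and every $\varphi\in C^2(B_\rho(x_0))$, $\rho>0$, such that $x_0$ is a minimum (resp. maximum) point of $u-\varphi$, $$\sup_{(V_1,\dots,V_\ell)}\sum_{i=1}^\ell C_{k_i,s}\Big\{P.V.\int_{V_i\cap B_\rho(0)}\frac{\varphi(x_0+z)-\varphi(x_0)}{|z|^{k_i+2s}}d\mathcal{H}^{k_i}(z)+\int_{V_i\setminus B_\rho(0)}\frac{u(x_0+z)-u(x_0)}{|z|^{k_i+2s}}d\mathcal{H}^{k_i}(z)\Big\}+g(x_0,u(x_0))\le0\ (\text{resp. }\ge0),$$ the supremum being over the same families. For $\mathcal{K}^-_{k_1,\dots,k_\ell}$ replace the supremum by the infimum. A subsolution (resp. supersolution) of the Dirichlet problem is in addition $\le0$ (resp. $\ge0$) in $\mathbb{R}^N\setminus\Omega$. *)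

(* Defs.v *)
From HB Require Import structures.
From mathcomp Require Import all_boot all_order all_algebra.
From mathcomp Require Import all_classical all_reals all_analysis.

Set Implicit Arguments.
Unset Strict Implicit.
Unset Printing Implicit Defensive.
Import Order.TTheory GRing.Theory Num.Theory.
Import numFieldNormedType.Exports.

Local Open Scope classical_set_scope.
Local Open Scope ring_scope.

(* The library norm on 'rV[R]_N is the sup norm: it induces the usual topology,
   which is all it is used for; lengths and balls are Euclidean. *)
Section euclidean.
Context {R : realType} {N : nat}.
Implicit Types (x y : 'rV[R]_N) (A : set 'rV[R]_N).

Definition edot x y : R := \sum_(i < N) x 0 i * y 0 i.
Definition enorm x : R := Num.sqrt (edot x x).
Definition eball x (r : R) : set 'rV[R]_N := [set y | enorm (y - x) < r].

(* ediam set0 = -oo *)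
Definition ediam A : \bar R :=
  ereal_sup [set (enorm (x - y))%:E | x in A & y in A].

End euclidean.

Section hausdorff.
Context {R : realType} {N : nat}.
Implicit Types (A : set 'rV[R]_N) (n : nat) (d : R).
Local Open Scope ereal_scope.

(* Convention: diam(set0)^n = 0, including for n = 0. *)
Definition diam_gauge n A : \bar R := if A == set0 then 0 else ediam A ^+ n.

Definition diam_cover d A : set (set 'rV[R]_N)^nat :=
  [set F | (forall i, ediam (F i) <= d%:E) /\ A `<=` \bigcup_i F i].

Definition hausdorff_pre n d A : \bar R :=
  ereal_inf [set \sum_(i <oo) diam_gauge n (F i) | F in diam_cover d A].

(* n-dimensional Hausdorff outer measure, normalized as in Mattila, Falconer and
   Rogers: no constant factor in front of diam^n. On an n-dimensional subspace it
   is (2 ^ n / vol (unit ball of R^n)) times Lebesgue measure, and the sphere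
   factor of the polar coordinates, n * H^n (unit ball) = n * 2 ^ n, is >= 1 for
   all n >= 1. With Lebesgue normalization that factor is the area of S^(n-1),
   which tends to 0, and comparison fails in high dimension under a smallness
   condition on c^+ that does not mention it. *)
Definition hausdorff n A : \bar R :=
  ereal_sup [set hausdorff_pre n d A | d in [set d : R | (0 < d)%R]].

Lemma enorm_ge0 (x : 'rV[R]_N) : (0 <= enorm x)%R.
Proof. exact: sqrtr_ge0. Qed.

Lemma ediam_ge0 A : A !=set0 -> 0 <= ediam A.
Proof.
move=> [x Ax]; apply: (@le_trans _ _ (enorm (x - x))%:E).
  by rewrite lee_fin enorm_ge0.
by apply: ereal_sup_ubound; exists x => //; exists x.
Qed.

Lemma diam_gauge_ge0 n A : 0 <= diam_gauge n A.
Proof.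
rewrite /diam_gauge; case: ifPn => // /set0P A0.
exact/expe_ge0/ediam_ge0.
Qed.

Lemma diam_gauge0 n : diam_gauge n set0 = 0.
Proof. by rewrite /diam_gauge eqxx. Qed.

Lemma hausdorff_pre_ge0 n d A : 0 <= hausdorff_pre n d A.
Proof.
apply: le_ereal_inf_tmp => _ [F _ <-].
by apply: nneseries_ge0 => i _ _; exact: diam_gauge_ge0.
Qed.

Lemma hausdorff_pre0 n d : hausdorff_pre n d set0 = 0.
Proof.
apply/eqP; rewrite eq_le hausdorff_pre_ge0 andbT.
apply: ereal_inf_lbound; exists (fun=> set0).
  split=> [i|//]; rewrite /ediam.
  by apply: ge_ereal_sup => _ [x []].
by rewrite eseries0// => i _ _; exact: diam_gauge0.
Qed.

Lemma le_hausdorff_pre n d : {homo hausdorff_pre n d : A B / A `<=` B >-> A <= B}.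
Proof.
move=> A B AB; apply/ereal_inf_le_tmp => x [F [dF BF]] <-.
by exists F => //; split => //; exact: subset_trans AB BF.
Qed.

Lemma hausdorff_pre_sigma_subadditive n d : sigma_subadditive (hausdorff_pre n d).
Proof.
move=> A; have [[i ioo]|] := pselect (exists i, hausdorff_pre n d (A i) = +oo).
  rewrite (eseries_pinfty _ _ ioo) ?leey// => m _.
  by rewrite -ltNye (lt_le_trans _ (hausdorff_pre_ge0 _ _ _)).
rewrite -forallNE => Aoo.
suff add2e (e : {posnum R}) : hausdorff_pre n d (\bigcup_m A m) <=
    \sum_(i <oo) hausdorff_pre n d (A i) + e%:num%:E.
  by apply/lee_addgt0Pr => _/posnumP[].
rewrite (le_trans _ (epsilon_trick _ _ _))//; last first.
  by move=> m; exact: hausdorff_pre_ge0.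
pose P m (B : (set 'rV[R]_N)^nat) := diam_cover d (A m) B /\
  \sum_(k <oo) diam_gauge n (B k) <=
  hausdorff_pre n d (A m) + (e%:num / (2 ^ m.+1)%:R)%:E.
have [G PG] : {G : ((set 'rV[R]_N)^nat)^nat & forall m, P m (G m)}.
  apply: (@choice _ _ P) => m; rewrite /P /hausdorff_pre.
  set S := (X in ereal_inf X); move infS : (ereal_inf S) => iS.
  case: iS infS => [r Sr|Soo|Soo].
  - have en1 : (0 < e%:num / (2 ^ m.+1)%:R)%R by [].
    have /(lb_ereal_inf_adherent en1) : ereal_inf S \is a fin_num by rewrite Sr.
    move=> [x [B mB muBx] xS].
    by exists B; split => //; rewrite muBx -Sr; exact/ltW.
  - by have := Aoo m; rewrite /hausdorff_pre -/S Soo.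
  - by have := hausdorff_pre_ge0 n d (A m); rewrite /hausdorff_pre -/S Soo.
have G_ge0 x : 0 <= (diam_gauge n \o uncurry G) x by exact: diam_gauge_ge0.
apply: (@le_trans _ _ (\esum_(i in setT) (diam_gauge n \o uncurry G) i)).
  apply: ereal_inf_lbound => /=.
  have /card_esym/ppcard_eqP[f] := card_nat2.
  exists (uncurry G \o f).
    split => [i|]; first by rewrite /= /uncurry; case: (f i) => a b; exact: (PG a).1.1.
    apply: (@subset_trans _  (\bigcup_m \bigcup_k G m k)) => [t [i _]|].
      by move=> /(PG i).1.2 -[j _ ?]; exists i => //; exists j.
    move=> t [i _ [j _ Bijt]]; exists (f^-1%FUN (i, j)) => //=.
    by rewrite invK ?inE.
  rewrite -(esum_pred_image (diam_gauge n \o uncurry G) _ xpredT)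
    ?[fun=> _]set_true//.
  by rewrite image_eq.
rewrite (_ : esum _ _ = \sum_(i <oo) \sum_(j <oo ) diam_gauge n (G i j)); last first.
  pose J : nat -> set (nat * nat) := fun i => [set (i, j) | j in setT].
  rewrite (_ : setT = \bigcup_k J k); last first.
    by rewrite predeqE => -[a b]; split => // _; exists a => //; exists b.
  rewrite esum_bigcupT /=; last 2 first.
    - apply/trivIsetP => i j _ _ ij.
      rewrite predeqE => -[p q] /=; split => //= -[] [_] _ [<-{p} _].
      by move=> [m' _] [] /esym/eqP; rewrite (negbTE ij).
    - by move=> /= [p q]; exact: diam_gauge_ge0.
  rewrite -(image_id [set: nat]) -fun_true esum_pred_image//; last first.
    by move=> p _; apply: esum_ge0 => q _; exact: diam_gauge_ge0.
  apply: eq_eseriesr => /= j _.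
  rewrite -(esum_pred_image (diam_gauge n \o uncurry G) (pair j) predT)//=; last first.
    by move=> ? ? _ _; exact: (@can_inj _ _ _ snd).
    by move=> m _; exact: diam_gauge_ge0.
  by congr esum; rewrite predeqE => -[a b]; split; move=> [i _ <-]; exists i.
apply: lee_lim.
- apply: is_cvg_nneseries => p *.
  by apply: nneseries_ge0 => m *; exact: (G_ge0 (p, m)).
- by apply: is_cvg_nneseries => p *; apply: adde_ge0 => //; exact: hausdorff_pre_ge0.
- by apply: nearW => p; apply: lee_sum => i _; exact: (PG i).2.
Qed.

Lemma hausdorff_pre_le n d A : (0 < d)%R -> hausdorff_pre n d A <= hausdorff n A.
Proof. by move=> d0; apply: ereal_sup_ubound; exists d. Qed.

Lemma hausdorff_ge0 n A : 0 <= hausdorff n A.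
Proof.
by rewrite (le_trans (hausdorff_pre_ge0 n 1 A))// hausdorff_pre_le.
Qed.

Lemma hausdorff0 n : hausdorff n set0 = 0.
Proof.
apply/eqP; rewrite eq_le hausdorff_ge0 andbT.
by apply: ge_ereal_sup => _ [d _ <-]; rewrite hausdorff_pre0.
Qed.

Lemma le_hausdorff n : {homo hausdorff n : A B / A `<=` B >-> A <= B}.
Proof.
move=> A B AB; apply: ge_ereal_sup => _ [d d0 <-].
exact: le_trans (le_hausdorff_pre n d AB) (hausdorff_pre_le n B d0).
Qed.

Lemma hausdorff_sigma_subadditive n : sigma_subadditive (hausdorff n).
Proof.
move=> A; apply: ge_ereal_sup => _ [d d0 <-].
apply: (le_trans (hausdorff_pre_sigma_subadditive n d A)).
apply: lee_nneseries => i _; first by move=> _; exact: hausdorff_pre_ge0.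
exact: hausdorff_pre_le.
Qed.

HB.instance Definition _ n := isOuterMeasure.Build R 'rV[R]_N (hausdorff n)
  (hausdorff0 n) (hausdorff_ge0 n) (@le_hausdorff n)
  (@hausdorff_sigma_subadditive n).

End hausdorff.

Definition hausdorff_outer (R : realType) (N n : nat) :
  {outer_measure set 'rV[R]_N -> \bar R} := @hausdorff R N n.

(* R^N with the sigma-algebra of Caratheodory H^n-measurable sets. *)
Notation hausdorff_space R N n := (caratheodory_type (hausdorff_outer R N n)).

Definition hausdorff_measure (R : realType) (N n : nat) :
    {measure set (hausdorff_space R N n) -> \bar R} :=
  (hausdorff_outer R N n : set (hausdorff_space R N n) -> \bar R).

Section regularity.
Context {R : realType} {N : nat}.
Implicit Types (A U : set 'rV[R]_N) (f : 'rV[R]_N -> R).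

Definition lsc_on A f :=
  @lower_semicontinuous (subspace A) R (EFin \o f).

Definition usc_on A f := lsc_on A (fun x => - f x).

(* For open U: partial derivatives exist and are continuous on U. *)
Definition C1_on U f := forall x, U x -> forall i : 'I_N,
  derivable f x (delta_mx 0 i) /\ {for x, continuous ('D_(delta_mx 0 i) f)}.

Definition C2_on U f :=
  C1_on U f /\ forall i : 'I_N, C1_on U ('D_(delta_mx 0 i) f).

(* Viscosity notions evaluate functions pointwise, also on null sets, so members
   of L^oo are genuine measurable functions that are bounded everywhere. *)
Definition Linfty (f : 'rV[R]_N -> R) :=
  measurable_fun [set: hausdorff_space R N N] (f : hausdorff_space R N N -> R) /\
  exists M : R, forall x, `|f x| <= M.

Definition is_domain U := [/\ open U, connected U & U !=set0].

End regularity.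

(* K^+ and K^- are handled together. *)
Variant extremal := Kplus | Kminus.

Section nonlocal.
Context {R : realType} {N l : nat}.
Variables (C : nat -> R -> R) (s : R) (k : 'I_l -> nat).
Implicit Types (V : {vspace 'rV[R]_N}) (x : 'rV[R]_N) (u w : 'rV[R]_N -> R).

Definition extr (e : extremal) (S : set \bar R) : \bar R :=
  if e is Kplus then ereal_sup S else ereal_inf S.

Definition frames : set ('I_l -> {vspace 'rV[R]_N}) :=
  [set Vs | (forall i, \dim (Vs i) = k i) /\
    forall i j, i != j -> forall x y, x \in Vs i -> y \in Vs j -> edot x y = 0].

Definition quot n w x (z : 'rV[R]_N) : R :=
  (w (x + z) - w x) / enorm z `^ (n%:R + 2 * s).

Definition pv_ball n V w x (rho : R) : \bar R :=
  lim ((\int[hausdorff_measure R N n]_(z in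
          [set` V] `&` (eball 0 rho `\` eball 0 eps)) (quot n w x z)%:E)%E
       @[eps --> 0^'+]).

Definition tail n V w x (rho : R) : \bar R :=
  (\int[hausdorff_measure R N n]_(z in [set` V] `\` eball 0 rho)
     (quot n w x z)%:E)%E.

(* phi near x, u away from x *)
Definition visc_op (e : extremal) phi u x (rho : R) : \bar R :=
  extr e [set (\sum_(i < l) (C (k i) s)%:E *
                 (pv_ball (k i) (Vs i) phi x rho + tail (k i) (Vs i) u x rho))%E
         | Vs in frames].

(* Measurability of u on the k i-planes through points of Omega, without which
   the integrals in the viscosity inequalities are meaningless; it does not
   follow from measurability on R^N, but holds for every Borel u. *)
Definition plane_measurable (Omega : set 'rV[R]_N) u :=
  forall x, Omega x -> forall i V, \dim V = k i ->
  measurable_fun ([set` V] : set (hausdorff_space R N (k i)))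
    ((fun z => u (x + z)) : hausdorff_space R N (k i) -> R).

(* Viscosity sub- and supersolutions of  K u + g (x, u) = 0  in Omega. *)
Definition viscosity_subsolution e (Omega : set 'rV[R]_N)
    (g : 'rV[R]_N -> R -> R) u :=
  [/\ Linfty u, plane_measurable Omega u, usc_on Omega u &
   forall (x0 : 'rV[R]_N) (rho : R) (phi : 'rV[R]_N -> R), Omega x0 -> 0 < rho -> C2_on (eball x0 rho) phi ->
     (forall y, eball x0 rho y -> u y - phi y <= u x0 - phi x0) ->
     (0 <= visc_op e phi u x0 rho + (g x0 (u x0))%:E)%E].

Definition viscosity_supersolution e (Omega : set 'rV[R]_N)
    (g : 'rV[R]_N -> R -> R) u :=
  [/\ Linfty u, plane_measurable Omega u, lsc_on Omega u &
   forall (x0 : 'rV[R]_N) (rho : R) (phi : 'rV[R]_N -> R), Omega x0 -> 0 < rho -> C2_on (eball x0 rho) phi ->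
     (forall y, eball x0 rho y -> u x0 - phi x0 <= u y - phi y) ->
     (visc_op e phi u x0 rho + (g x0 (u x0))%:E <= 0)%E].

Definition dirichlet_subsolution e Omega g u :=
  viscosity_subsolution e Omega g u /\ forall x, ~ Omega x -> u x <= 0.

Definition dirichlet_supersolution e Omega g u :=
  viscosity_supersolution e Omega g u /\ forall x, ~ Omega x -> 0 <= u x.

End nonlocal.

(* Main.v *)
Require Import Defs.
From mathcomp Require Import all_boot all_order all_algebra finmap.
From mathcomp Require Import all_classical all_reals all_analysis measurable_realfun.
From mathcomp Require Import ring lra.
Import Order.TTheory GRing.Theory Num.Theory.
Import numFieldNormedType.Exports.
Local Open Scope classical_set_scope.
Local Open Scope ring_scope.

(** Suppose that [u x0 > v x0], and put [M = u x0 - v x0]. Let [(x, y)] maximize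
    [u x - v y - alpha * |x - y| ^ 2] over pairs of points of the closure of
    [Omega]. For [alpha] large, [x] and [y] are close to each other, lie in
    [Omega], and satisfy [u x - v y >= M] ([doubling_max], [near_diagonal]). The
    quadratic [alpha * |. - y| ^ 2] touches [u] from above at [x], and
    [- alpha * |x - .| ^ 2] touches [v] from below at [y], so both viscosity
    inequalities apply. They are compared on one and the same frame, chosen
    almost optimal on one side ([common_frame]); it remains to bound the
    difference of the two operators on a single plane [V] of dimension [n].

    Inside the ball of radius [rho], the linear parts of the test functions are
    odd and disappear from the principal values, while the quadratic parts
    contribute at most a constant times [alpha * rho ^ (2 - 2 s)]
    ([pv_ball_quadratic]). Outside of it, the comparison of the increments
    [u (x + z) - v (y + z) <= u x - v y] holds for every [z]: if both points are
    in [Omega], by maximality; if neither is, by the boundary values; and if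
    exactly one is, that point is close to the complement of [Omega], where
    semicontinuity bounds the values by [M] ([usc_small_near_complement]). When
    [|z|] is at least the diameter [D] of [Omega], both points are outside of
    [Omega], and the left-hand side is even [<= 0]. The tails thus differ by at
    least [u x - v y] times the integral of [|z| ^ - (n + 2 s)] over [|z| >= D],
    which is at least [D ^ - (2 s) / (2 s)] ([tail_gap], [tail_kernel_ge]).
    For [alpha] large and then [rho] small, the two inequalities yield
    [kappa * (u x - v y) <= sup c^+ * (u x - v y)] up to small errors,
    where [kappa] is the right-hand side of the assumption on [c]: this is
    impossible.

    The integrals on [V] only use the homogeneity of the Hausdorff measure
    [H^n]. It is a metric outer measure, so Lipschitz functions are measurable
    ([lipschitz_measurable]), and the balls of radius [r] centred in [V] have
    measure [r ^ n * hball n V] ([hausdorff_eball]). Grids show that [hball n V]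
    is finite and positive ([hball_lty], [hball_gt0]), and then a covering
    argument shows that it is at least 1 ([hball_ge1]). Every integral that
    occurs is proportional to [hball n V], which makes the estimates uniform
    in [V]. *)

Set Implicit Arguments.
Unset Strict Implicit.
Unset Printing Implicit Defensive.

(** * The Euclidean norm *)

Section euclidean_norm.
Context {R : realType} {N : nat}.
Implicit Types (x y z : 'rV[R]_N) (a b : R).

Lemma edotC x y : edot x y = edot y x.
Proof. by apply: eq_bigr => i _; rewrite mulrC. Qed.

Lemma edotDl x y z : edot (x + y) z = edot x z + edot y z.
Proof. by rewrite -big_split; apply: eq_bigr => i _; rewrite mxE mulrDl. Qed.

Lemma edotZl a x y : edot (a *: x) y = a * edot x y.
Proof. by rewrite /edot mulr_sumr; apply: eq_bigr => i _; rewrite mxE mulrA. Qed.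

Lemma edotDr x y z : edot x (y + z) = edot x y + edot x z.
Proof. by rewrite edotC edotDl !(edotC x). Qed.

Lemma edotZr a x y : edot x (a *: y) = a * edot x y.
Proof. by rewrite edotC edotZl (edotC x). Qed.

Lemma edot0l y : edot 0 y = 0.
Proof. by rewrite -(scale0r y) edotZl mul0r. Qed.

Lemma edotNr x y : edot x (- y) = - edot x y.
Proof. by rewrite -scaleN1r edotZr mulN1r. Qed.

Lemma edotNl x y : edot (- x) y = - edot x y.
Proof. by rewrite edotC edotNr edotC. Qed.

Lemma edot_ge0 x : 0 <= edot x x.
Proof. by apply: sumr_ge0 => i _; rewrite -expr2 sqr_ge0. Qed.

Lemma enorm_sq x : enorm x ^+ 2 = edot x x.
Proof. by rewrite sqr_sqrtr// edot_ge0. Qed.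

Lemma coord_le_enorm x i : `|x 0 i| <= enorm x.
Proof.
rewrite -sqrtr_sqr ler_wsqrtr// expr2 /edot (bigD1 i)//= lerDl.
by apply: sumr_ge0 => j _; rewrite -expr2 sqr_ge0.
Qed.

Lemma norm_le_enorm x : `|x| <= enorm x.
Proof.
rewrite /Num.Def.normr/= mx_normrE; apply/bigmax_leP; split; first exact: enorm_ge0.
by move=> [i j] _ /=; rewrite (ord1 i) coord_le_enorm.
Qed.

Lemma coord_le_norm x i : `|x 0 i| <= `|x|.
Proof.
rewrite [leRHS]/Num.Def.normr/= mx_normrE.
by apply/bigmax_geP; right => /=; exists (0, i).
Qed.

Lemma enorm_le_norm x : enorm x <= N%:R * `|x|.
Proof.
rewrite -[leRHS]ger0_norm ?mulr_ge0// -sqrtr_sqr ler_wsqrtr//.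
apply: (@le_trans _ _ (\sum_(i < N) `|x| ^+ 2)).
  apply: ler_sum => i _; rewrite -expr2 -real_normK ?num_real//.
  by rewrite lerXn2r ?nnegrE// coord_le_norm.
rewrite sumr_const card_ord -[leLHS]mulr_natl exprMn ler_wpM2r ?sqr_ge0//.
by rewrite -natrX ler_nat -[leqLHS]expn1; case: (N) => // n; rewrite leq_pexp2l.
Qed.

Lemma enorm0 : enorm (0 : 'rV[R]_N) = 0.
Proof. by apply/eqP; rewrite eq_le enorm_ge0 (le_trans (enorm_le_norm _))// normr0 mulr0. Qed.

Lemma enorm0_eq0 x : enorm x = 0 -> x = 0.
Proof. by move=> x0; apply/eqP; rewrite -normr_le0 -x0 norm_le_enorm. Qed.

Lemma enormZ a x : enorm (a *: x) = `|a| * enorm x.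
Proof. by rewrite /enorm edotZl edotZr mulrA -expr2 sqrtrM ?sqr_ge0// sqrtr_sqr. Qed.

Lemma enormN x : enorm (- x) = enorm x.
Proof. by rewrite -scaleN1r enormZ normrN1 mul1r. Qed.

Lemma enormB x y : enorm (x - y) = enorm (y - x).
Proof. by rewrite -enormN opprB. Qed.

(** Cauchy-Schwarz, from the positivity of [|y| *: x - |x| *: y]. *)
Lemma edot_le x y : edot x y <= enorm x * enorm y.
Proof.
have := edot_ge0 (enorm y *: x - enorm x *: y).
rewrite !(edotDl,edotDr,edotNr,edotNl,edotZr,edotZl) -!enorm_sq (edotC y x) => h.
have [x0|x0] := eqVneq (enorm x) 0.
  by rewrite (enorm0_eq0 x0) edot0l enorm0 mul0r.
have [y0|y0] := eqVneq (enorm y) 0.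
  by rewrite (enorm0_eq0 y0) edotC edot0l enorm0 mulr0.
have {}x0 : 0 < enorm x by rewrite lt_def x0 enorm_ge0.
have {}y0 : 0 < enorm y by rewrite lt_def y0 enorm_ge0.
rewrite -subr_ge0 -(pmulr_rge0 _ (mulr_gt0 x0 y0)). nra.
Qed.

Lemma enorm_triangle x y : enorm (x + y) <= enorm x + enorm y.
Proof.
rewrite -(@ler_pXn2r _ 2)// ?nnegrE ?addr_ge0 ?enorm_ge0//.
rewrite enorm_sq edotDl !edotDr sqrrD !enorm_sq (edotC y x).
by have := edot_le x y; lra.
Qed.

Lemma enorm_triangleB x y z : enorm (x - z) <= enorm (x - y) + enorm (y - z).
Proof. by rewrite (le_trans _ (enorm_triangle _ _))// addrA subrK. Qed.

Lemma enorm_lip x y : `|enorm x - enorm y| <= enorm (x - y).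
Proof.
have := enorm_triangle (x - y) y; have := enorm_triangle (y - x) x.
by rewrite !subrK (enormB y x) ler_norml => *; apply/andP; split; lra.
Qed.

(** The topology of row vectors is that of the sup norm; Euclidean balls generate
    it as well. *)
Lemma nbhs_eballP x (U : set 'rV[R]_N) :
  nbhs x U <-> exists2 a, 0 < a & eball x a `<=` U.
Proof.
split=> [/nbhs_ballP[a /= a0 aU]|[a a0 aU]].
  exists a => // y xy; apply: aU; rewrite -ball_normE /= distrC.
  exact: le_lt_trans (norm_le_enorm _) xy.
have N1 : 0 < (N%:R + 1 : R) by rewrite ltr_pwDr.
apply/nbhs_ballP; exists (a / (N%:R + 1)) => /=; first by rewrite divr_gt0.
move=> y; rewrite -ball_normE /= distrC ltr_pdivlMr// => xy; apply: aU.
apply: le_lt_trans (enorm_le_norm _) _; apply: le_lt_trans xy.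
by rewrite mulrC ler_wpM2l// lerDl.
Qed.

Lemma near_eball x a : 0 < a -> nbhs x (eball x a).
Proof. by move=> a0; apply/nbhs_eballP; exists a. Qed.

End euclidean_norm.

(** * Measurability of Lipschitz functions for the Hausdorff measure *)

Section caratheodory_criterion.
Context {R : realType} {N : nat}.
Implicit Types (A B X : set 'rV[R]_N) (n : nat).
Local Open Scope ereal_scope.

Lemma nneseries_le (u : nat -> \bar R) c :
  (forall i, 0 <= u i) -> (forall n, \sum_(0 <= i < n) u i <= c) ->
  \sum_(i <oo) u i <= c.
Proof.
move=> u0 uc; apply: lime_le; first exact: is_cvg_nneseries.
exact: nearW.
Qed.

Lemma ereal_supD_le (S T : set (\bar R)) c :
  S !=set0 -> T !=set0 -> (forall x, S x -> 0 <= x) -> (forall y, T y -> 0 <= y) ->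
  (forall x y, S x -> T y -> x + y <= c) -> ereal_sup S + ereal_sup T <= c.
Proof.
move=> [x0 Sx0] [y0 Ty0] S0 T0 ST.
have c0 : 0 <= c by rewrite (le_trans _ (ST _ _ Sx0 Ty0))// adde_ge0//; [exact: S0|exact: T0].
have [->|cy] := eqVneq c +oo; first by rewrite leey.
have cfin : c \is a fin_num by rewrite ge0_fin_numE// ltey.
have Tfin y : T y -> y \is a fin_num.
  move=> Ty; rewrite ge0_fin_numE ?T0//; apply: (@le_lt_trans _ _ c); last by rewrite ltey.
  by rewrite (le_trans _ (ST _ _ Sx0 Ty))// leeDr// S0.
have Sc y : T y -> ereal_sup S <= c - y.
  move=> Ty; apply: ge_ereal_sup => x Sx.
  by rewrite leeBrDr ?Tfin// ST.
have Sfin : ereal_sup S \is a fin_num.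
  rewrite ge0_fin_numE; last by rewrite (le_trans (S0 _ Sx0))// ereal_sup_ubound.
  rewrite (le_lt_trans (Sc _ Ty0))// ltey_eq fin_numB cfin Tfin// orbT.
rewrite -leeBrDl//; apply: ge_ereal_sup => y Ty.
by rewrite leeBrDl// -leeBrDr ?Tfin// Sc.
Qed.

(** A cover by sets of diameter less than the distance between [A] and [B]
    splits into a cover of [A] and a cover of [B]. *)
Lemma hausdorff_metric n A B (d : R) : (0 < d)%R ->
  (forall x y, A x -> B y -> d <= enorm (x - y))%R ->
  hausdorff n A + hausdorff n B <= hausdorff n (A `|` B).
Proof.
move=> d0 AB; apply: ereal_supD_le.
- by exists (hausdorff_pre n 1 A); exists 1%R => //=.
- by exists (hausdorff_pre n 1 B); exists 1%R => //=.
- by move=> _ [e _ <-]; exact: hausdorff_pre_ge0.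
- by move=> _ [e _ <-]; exact: hausdorff_pre_ge0.
move=> _ _ [e1 /= e10 <-] [e2 /= e20 <-].
pose e := (Num.min (Num.min e1 e2) (d / 2))%R.
have e0 : (0 < e)%R by rewrite !lt_min e10 e20 divr_gt0.
apply: le_trans (hausdorff_pre_le n (A `|` B) e0).
apply: le_ereal_inf_tmp => _ [F [Fe ABF] <-].
pose G (C : set 'rV[R]_N) i := if `[< F i `&` C !=set0 >] then F i else set0.
have Gcov C e' : C `<=` A `|` B -> (e <= e')%R -> (0 < e')%R -> diam_cover e' C (G C).
  move=> CAB ee' e'0; split=> [i|x Cx].
    rewrite /G; case: asboolP => _; first by rewrite (le_trans (Fe i))// lee_fin.
    rewrite /ediam; apply: (@ge_ereal_sup); by move=> _ [x []].
  have [i _ Fix] := ABF _ (CAB _ Cx); exists i => //.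
  by rewrite /G; case: asboolP => // -[]; exists x.
apply: (@le_trans _ _ (\sum_(i <oo) diam_gauge n (G A i)
                     + \sum_(i <oo) diam_gauge n (G B i))).
  apply: leeD.
  - apply: ereal_inf_lbound; exists (G A) => //.
    by apply: Gcov => //; rewrite !ge_min lexx.
  - apply: ereal_inf_lbound; exists (G B) => //.
    by apply: Gcov => //; rewrite !ge_min lexx orbT.
rewrite -nneseriesD; [|by move=> *; exact: diam_gauge_ge0..].
apply: lee_nneseries => i _; first by move=> _; rewrite adde_ge0 ?diam_gauge_ge0.
rewrite /G; case: asboolP => [[x [Fx Ax]]|_]; last first.
  by rewrite diam_gauge0 add0e; case: asboolP => // _; rewrite diam_gauge0 diam_gauge_ge0.
case: asboolP => [[y [Fy By]]|_]; last by rewrite diam_gauge0 adde0.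
exfalso; have : (enorm (x - y))%:E <= e%:E.
  by apply: le_trans (Fe i); apply: ereal_sup_ubound; exists x => //; exists y.
rewrite lee_fin => xye; have := AB _ _ Ax By.
have : (e <= d / 2)%R by rewrite ge_min lexx orbT.
by move: xye d0; lra.
Qed.

Lemma hausdorffU n A B : hausdorff n (A `|` B) <= hausdorff n A + hausdorff n B.
Proof. exact: (outer_measureU2 (hausdorff_outer R N n)). Qed.

(** Caratheodory's criterion. The sublevel set [g < r] is exhausted by the sets
    [g < r - t j], which are at positive distance from its complement. Shells
    between successive levels, when of the same parity, are also at positive
    distance from each other, so their measures within [X] are summable, and the
    measure of what the exhaustion misses tends to 0. *)
Lemma lipschitz_caratheodory n (g : 'rV[R]_N -> R) (K r : R) : (0 < K)%R ->
  (forall x y, `|g x - g y| <= K * enorm (x - y))%R ->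
  (hausdorff_outer R N n).-caratheodory [set x | (g x < r)%R].
Proof.
move=> K0 gK; apply: le_caratheodory_measurable => X.
have [Xoo|Xfin] := eqVneq (hausdorff n X) +oo.
  by rewrite /hausdorff_outer /= Xoo leey.
have sep Y Z a b : (a < b)%R -> (forall y, Y y -> X y /\ g y < a)%R ->
    (forall z, Z z -> X z /\ b <= g z)%R ->
    hausdorff n Y + hausdorff n Z <= hausdorff n (Y `|` Z).
  move=> ab Ya Zb; apply: (@hausdorff_metric n Y Z ((b - a) / K)%R).
    by rewrite divr_gt0// subr_gt0.
  move=> y z /Ya[_ ya] /Zb[_ zb]; rewrite ler_pdivrMr// mulrC.
  apply: le_trans (gK _ _); rewrite distrC; apply: le_trans (ler_norm _).
  by lra.
pose t (j : nat) : R := (j.+1%:R^-1)%R.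
have tS j : (t j.+1 < t j)%R by rewrite ltf_pV2 ?posrE// ltr_nat.
have t0 j : (0 < t j)%R by rewrite invr_gt0.
pose P j := X `&` [set x | (g x < r - t j)%R].
pose S j := X `&` [set x | (r - t j.+1 <= g x < r - t j.+2)%R].
set Q := X `&` ~` _.
have HX Y : Y `<=` X -> hausdorff n Y <= hausdorff n X.
  exact: le_hausdorff.
have PQ j : hausdorff n (P j) + hausdorff n Q <= hausdorff n X.
  apply: (@le_trans _ _ (hausdorff n (P j `|` Q))); last first.
    by apply: HX => x [[]|[]].
  apply: (sep _ _ (r - t j)%R r).
  + by have := t0 j; lra.
  + by move=> y [].
  + by move=> z [Xz /negP]; rewrite -leNgt.
have Spar p J : \sum_(j < J) hausdorff n (S (2 * j + p)%N) <=
    hausdorff n (P (2 * J + p)%N).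
  elim: J => [|J IH]; first by rewrite big_ord0 hausdorff_ge0.
  rewrite big_ord_recr /=; apply: le_trans (leeD2r _ IH) _.
  apply: (@le_trans _ _ (hausdorff n (P (2 * J + p)%N `|` S (2 * J + p)%N))).
    apply: (sep _ _ (r - t (2 * J + p))%R (r - t (2 * J + p).+1)%R).
    + by have := tS (2 * J + p)%N; lra.
    + by move=> y [].
    + by move=> z [Xz /andP[]].
  apply: le_hausdorff; rewrite mulnS -addnA add2n.
  move=> x [[Xx /= gx]|[Xx /= /andP[_ gx]]]; split => //=.
  by have := tS (2 * J + p)%N; have := tS (2 * J + p).+1; lra.
have Ssum : \sum_(j <oo) hausdorff n (S j) < +oo.
  apply: (@le_lt_trans _ _ (hausdorff n X + hausdorff n X)); last first.
    by rewrite lte_add_pinfty// ltey.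
  apply: nneseries_le => [i|m]; first exact: hausdorff_ge0.
  apply: (@le_trans _ _ (\sum_(0 <= j < m.*2) hausdorff n (S j))).
    apply: lee_sum_nneg_natr => [i _ _|]; first exact: hausdorff_ge0.
    by rewrite -addnn leq_addr.
  suff -> : \sum_(0 <= j < m.*2) hausdorff n (S j) =
     \sum_(j < m) hausdorff n (S (2 * j + 0)%N) + \sum_(j < m) hausdorff n (S (2 * j + 1)%N).
    by apply: leeD; apply: le_trans (Spar _ _) _; apply: HX => x [].
  elim: m => [|m IH]; first by rewrite !big_ord0 big_geq// adde0.
  rewrite doubleS !big_nat_recr//= IH !big_ord_recr/= -!addeA; congr (_ + _).
  by rewrite [RHS]addeCA mul2n addn0 addn1.
have tailS : \sum_(N <= k <oo) hausdorff n (S k) @[N --> \oo] --> 0.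
  by apply: nneseries_tail_cvg => // k _; exact: hausdorff_ge0.
apply/lee_addgt0Pr => e e0.
have e0E : (0 : \bar R) < e%:E by rewrite lte_fin.
have /tailS[m _ Hm] := open_ereal_lt' e0E.
have {}Hm := Hm m (leqnn m).
pose T i := if (m <= i)%N then S i else set0.
have XT : X `&` [set x | (g x < r)%R] `<=` P m.+1 `|` \bigcup_i T i.
  move=> x [Xx /= gx].
  have [|gm] := ltP (g x) (r - t m.+1)%R; first by left.
  right; have ex : exists k, (g x < r - t k)%R.
    have rg : (0 < r - g x)%R by rewrite subr_gt0.
    by have [k gk] := ltr_add_invr gx; exists k; rewrite ltrBrDr.
  have [k gk kmin] := ex_minnP ex.
  have mk : (m.+1 < k)%N.
    rewrite ltnNge; apply/negP => km.
    have : (t m.+1 <= t k)%R by rewrite lef_pV2 ?posrE// ler_nat.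
    by move: gm gk; lra.
  case: k mk gk kmin => [//|[//|j]] mj gj jmin.
  exists j => //; have mj' : (m <= j)%N by move: mj; rewrite !ltnS.
  rewrite /T mj'; split => //=.
  rewrite gj andbT leNgt; apply/negP => /jmin.
  by rewrite ltnn.
have HT : hausdorff n (\bigcup_i T i) <= \sum_(m <= k <oo) hausdorff n (S k).
  apply: le_trans (hausdorff_sigma_subadditive n T) _.
  rewrite [leRHS]eseries_cond [leRHS]eseries_mkcond.
  apply: lee_nneseries => i _; first by move=> _; exact: hausdorff_ge0.
  by rewrite /T; case: ifP => //= _; rewrite hausdorff0.
apply: (@le_trans _ _ (hausdorff n (P m.+1) + e%:E + hausdorff n Q)).
  apply: leeD2r; apply: le_trans (le_hausdorff n XT) _.
  apply: le_trans (hausdorffU _ _ _) _; apply: leeD2l.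
  exact: le_trans HT (ltW Hm).
by rewrite addeAC leeD2r.
Qed.

End caratheodory_criterion.

Lemma lipschitz_measurable {R : realType} {N : nat} (n : nat) (g : 'rV[R]_N -> R)
    (K : R) : (forall x y, `|g x - g y| <= K * enorm (x - y)) ->
  measurable_fun setT (g : Defs.hausdorff_space R N n -> R).
Proof.
move=> gK.
have gK1 x y : `|g x - g y| <= (`|K| + 1) * enorm (x - y).
  apply: le_trans (gK x y) _; rewrite ler_wpM2r ?enorm_ge0//.
  by rewrite (le_trans (ler_norm _))// lerDl.
apply: (measurability _ (measurable_realfun.RGenInftyO.measurableE R)) => //.
move=> _ [_ [r ->] <-]; rewrite setTI.
have -> : g @^-1` `]-oo, r[ = [set x | g x < r].
  by apply/seteqP; split=> x /=; rewrite in_itv.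
apply: (@lipschitz_caratheodory _ _ _ g (`|K| + 1)) => //.
Qed.

(** * Scaling of the Hausdorff measure *)

Section hausdorff_lipschitz_image.
Context {R : realType} {N : nat}.
Implicit Types (A B F : set 'rV[R]_N) (n : nat) (d : R).
Local Open Scope ereal_scope.

Lemma ediam_le F d : (forall x y, F x -> F y -> enorm (x - y) <= d)%R ->
  ediam F <= d%:E.
Proof.
move=> Fd; apply: ge_ereal_sup => _ [x Fx [y Fy <-]].
by rewrite lee_fin Fd.
Qed.

Lemma diam_gaugeE n F d : F !=set0 -> ediam F <= d%:E ->
  exists D : R, [/\ (0 <= D)%R, ediam F = D%:E & diam_gauge n F = (D ^+ n)%:E].
Proof.
move=> F0 Fd; have D0 := ediam_ge0 F0.
have Dfin : ediam F \is a fin_num by rewrite ge0_fin_numE// (le_lt_trans Fd) ?ltry.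
exists (fine (ediam F)); split; rewrite ?fine_ge0 ?fineK//.
rewrite /diam_gauge ifF; last by apply/negP => /eqP F00; move: F0; rewrite F00 => -[].
by rewrite EFin_expe fineK.
Qed.

Lemma enorm_le_ediam F (D : R) x y : ediam F = D%:E -> F x -> F y ->
  (enorm (x - y) <= D)%R.
Proof.
move=> FD Fx Fy; rewrite -lee_fin -FD.
by apply: ereal_sup_ubound; exists x => //; exists y.
Qed.

Lemma diam_gauge_le n F d : (0 <= d)%R ->
  (forall x y, F x -> F y -> enorm (x - y) <= d)%R -> diam_gauge n F <= (d ^+ n)%:E.
Proof.
move=> d0 Fd; have [->|/set0P F0] := eqVneq F set0.
  by rewrite diam_gauge0 lee_fin exprn_ge0.
have [D [D0 FD ->]] := diam_gaugeE n F0 (ediam_le Fd).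
by rewrite lee_fin lerXn2r ?nnegrE// -lee_fin -FD ediam_le.
Qed.

Lemma hausdorff_lipschitz n A (f : 'rV[R]_N -> 'rV[R]_N) (r : R) : (0 < r)%R ->
  (forall x y, A x -> A y -> enorm (f x - f y) <= r * enorm (x - y))%R ->
  hausdorff n (f @` A) <= (r ^+ n)%:E * hausdorff n A.
Proof.
move=> r0 fr; apply: ge_ereal_sup => _ [d /= d0 <-].
have dr0 : (0 < d / r)%R by rewrite divr_gt0.
apply: (@le_trans _ _ ((r ^+ n)%:E * hausdorff_pre n (d / r) A)); last first.
  by rewrite lee_pmul2l// ?lte_fin ?exprn_gt0// hausdorff_pre_le.
rewrite -lee_pdivrMl ?exprn_gt0//; apply: le_ereal_inf_tmp => _ [F [Fd AF] <-].
rewrite lee_pdivrMl ?exprn_gt0// -nneseriesZl; last by move=> i _; exact: diam_gauge_ge0.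
have Fe i x y : F i x -> F i y -> A x -> A y -> (enorm (f x - f y) <= r * fine (ediam (F i)))%R.
  move=> Fx Fy Ax Ay; apply: le_trans (fr _ _ Ax Ay) _; rewrite ler_pM2l//.
  have F0 : F i !=set0 by exists x.
  have [D [D0 FD _]] := diam_gaugeE 0 F0 (Fd i).
  by rewrite FD /= (enorm_le_ediam FD).
apply: (@le_trans _ _ (\sum_(i <oo) diam_gauge n (f @` (F i `&` A)))).
  apply: ereal_inf_lbound; exists (fun i => f @` (F i `&` A)) => //; split.
    move=> i; apply: ediam_le => _ _ [x [Fx Ax] <-] [y [Fy Ay] <-].
    apply: le_trans (Fe i _ _ Fx Fy Ax Ay) _.
    have F0 : F i !=set0 by exists x.
    have [D [D0 FD _]] := diam_gaugeE 0 F0 (Fd i).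
    rewrite FD /= mulrC -ler_pdivlMr// -lee_fin -FD.
    exact: Fd.
  by move=> _ [x Ax <-]; have [i _ Fix] := AF _ Ax; exists i => //; apply: imageP.
apply: lee_nneseries => i _; first by move=> _; exact: diam_gauge_ge0.
have [F0|/set0P F0] := eqVneq (F i) set0.
  by rewrite F0 set0I image_set0 diam_gauge0 mule0.
have [D [D0 FD ->]] := diam_gaugeE n F0 (Fd i).
rewrite -EFinM -exprMn; apply: diam_gauge_le; first by rewrite mulr_ge0// ltW.
move=> _ _ [x [Fx Ax] <-] [y [Fy Ay] <-].
by have := Fe i _ _ Fx Fy Ax Ay; rewrite FD.
Qed.

Lemma hausdorffN n A : hausdorff n (-%R @` A) = hausdorff n A.
Proof.
have le B : hausdorff n (-%R @` B) <= hausdorff n B.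
  rewrite -[leRHS]mul1e -(expr1n R n); apply: hausdorff_lipschitz => // x y _ _.
  by rewrite mul1r -opprD enormN.
apply/eqP; rewrite eq_le le /=; apply: le_trans (le (-%R @` A)).
by apply: le_hausdorff => x Ax; exists (- x)%R; [exact: imageP|exact: opprK].
Qed.

End hausdorff_lipschitz_image.

Section ball_measure.
Context {R : realType} {N : nat}.
Variables (n : nat) (V : {vspace 'rV[R]_N}).
Implicit Types (x y : 'rV[R]_N) (r : R).
Local Open Scope ereal_scope.

(** The measure of the unit ball of [V]. All the estimates below are multiples of
    this constant, of which only the bounds [1 <= hball < +oo] matter. *)
Definition hball : \bar R := hausdorff n ([set` V] `&` eball 0%R 1%R).

Lemma hball_ge0 : 0 <= hball. Proof. exact: hausdorff_ge0. Qed.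

(** The similarity [z |-> x + r *: z] and its inverse preserve [V]. *)
Lemma hausdorff_eball x r : x \in V -> (0 < r)%R ->
  hausdorff n ([set` V] `&` eball x r) = (r ^+ n)%:E * hball.
Proof.
move=> Vx r0; apply/eqP; rewrite eq_le; apply/andP; split.
  have -> : [set` V] `&` eball x r = (fun z => x + r *: z)%R @` ([set` V] `&` eball 0%R 1%R).
    apply/seteqP; split => [y [Vy yr]|_ [z [Vz z1] <-]].
      exists (r^-1 *: (y - x))%R.
        split; first by rewrite /= rpredZ// rpredB.
        by rewrite /eball /= subr0 enormZ gtr0_norm ?invr_gt0// ltr_pdivrMl// mulr1.
      by rewrite scalerA divff ?gt_eqF// scale1r addrC subrK.
    move: z1; rewrite /eball /= subr0 => z1; split; first by rewrite /= rpredD// rpredZ.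
    by rewrite /eball /= addrAC subrr add0r enormZ gtr0_norm// gtr_pMr.
  apply: hausdorff_lipschitz => // y z _ _.
  by rewrite opprD addrACA subrr add0r -scalerBr enormZ gtr0_norm.
rewrite -lee_pdivlMl ?exprn_gt0// -exprVn.
have {1}-> : hball = hausdorff n ((fun z => r^-1 *: (z - x))%R @` ([set` V] `&` eball x r)).
  congr hausdorff; apply/seteqP; split => [y [Vy y1]|_ [z [Vz zr] <-]].
    move: y1; rewrite /eball /= subr0 => y1; exists (x + r *: y)%R.
      split; first by rewrite /= rpredD// rpredZ.
      by rewrite /eball /= addrAC subrr add0r enormZ gtr0_norm// gtr_pMr.
    by rewrite addrAC subrr add0r scalerA mulVf ?gt_eqF// scale1r.
  split; first by rewrite /= rpredZ// rpredB.
  by rewrite /eball /= subr0 enormZ gtr0_norm ?invr_gt0// ltr_pdivrMl// mulr1.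
apply: hausdorff_lipschitz; first by rewrite invr_gt0.
by move=> y z _ _; rewrite -scalerBr opprB addrA subrK enormZ gtr0_norm ?invr_gt0.
Qed.

End ball_measure.

(** * Bounds on the measure of the unit ball of a subspace *)

(** Subtracting the least value of each coordinate maps [S] injectively into a
    cube with [K.+1] points along each edge. *)
Lemma card_grid_le (n M K : nat) (S : {set {ffun 'I_n -> 'I_M}}) :
  (forall f g, f \in S -> g \in S -> forall j, f j <= g j + K)%N ->
  (#|S| <= K.+1 ^ n)%N.
Proof.
move=> SK; have [->|[f0 f0S]] := set_0Vmem S; first by rewrite cards0.
pose a j := [arg min_(g < f0 in S) (g j : nat)] j.
have aP j f : f \in S -> (a j <= f j)%N.
  by move=> fS; rewrite /a; case: arg_minnP => // g gS /(_ _ fS).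
have aS j f : f \in S -> (f j <= a j + K)%N.
  by move=> fS; rewrite /a; case: arg_minnP => // g gS _; exact: SK.
pose phi (f : {ffun 'I_n -> 'I_M}) := [ffun j => inord (f j - a j) : 'I_K.+1].
have phi_inj : {in S &, injective phi}.
  move=> f g fS gS /ffunP fg; apply/ffunP => j; apply/val_inj.
  have /(congr1 val) := fg j; rewrite !ffunE /= !inordK ?ltnS ?leq_subLR ?aS//.
  by move=> /(congr1 (addn^~ (a j : nat))); rewrite !subnK ?aP.
rewrite -(card_in_imset phi_inj).
have <- : #|{ffun 'I_n -> 'I_K.+1}| = (K.+1 ^ n)%N by rewrite card_ffun !card_ord.
exact: max_card.
Qed.

Section basis_bounds.
Context {R : realType} {N : nat}.
Variables (n : nat) (V : {vspace 'rV[R]_N}) (dimV : \dim V = n).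

(** Coordinates [co] in a basis [X] of [V], together with the constants comparing
    the sup norm of the coordinates to the Euclidean norm: this is what grids of
    [V] are built with. *)
Lemma vspace_coordinates : exists (X : 'I_n -> 'rV[R]_N)
    (co : 'I_n -> 'rV[R]_N -> R) (A B : R),
  [/\ 0 < A, 0 < B, forall i, X i \in V &
   [/\ (forall v, v \in V -> v = \sum_i co i v *: X i),
       (forall (t : 'I_n -> R) j, co j (\sum_i t i *: X i) = t j),
       (forall i u v, co i (u - v) = co i u - co i v),
       (forall i v, `|co i v| <= B * enorm v) &
       (forall (t : 'I_n -> R) b, 0 <= b -> (forall i, `|t i| <= b) ->
          enorm (\sum_i t i *: X i) <= A * b)]].
Proof.
rewrite -dimV; pose Y := vbasis V.
have bY : basis_of V Y := vbasisP V.
exists (fun i => Y`_i), (fun i => coord Y i).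
exists (1 + \sum_(i < \dim V) enorm (Y`_i)).
exists (1 + \sum_(i < \dim V) \sum_(j < N) `|coord Y i (delta_mx 0 j)|).
split.
- by rewrite ltr_wpDr// sumr_ge0// => i _; exact: enorm_ge0.
- by rewrite ltr_wpDr// sumr_ge0// => i _; rewrite sumr_ge0.
- by move=> i; apply: vbasis_mem; rewrite mem_nth// size_tuple.
split.
- by move=> v Vv; exact: coord_vbasis.
- by move=> t j; rewrite coord_sum_free// (basis_free bY).
- by move=> i u v; rewrite linearB.
- move=> i v; rewrite {1}(row_sum_delta v) linear_sum.
  apply: le_trans (ler_norm_sum _ _ _) _.
  apply: (@le_trans _ _ (\sum_(j < N) `|coord Y i (delta_mx 0 j)| * enorm v)).
    apply: ler_sum => j _; rewrite linearZ normrM mulrC ler_wpM2l//.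
    exact: coord_le_enorm.
  rewrite -mulr_suml ler_wpM2r ?enorm_ge0//.
  rewrite [in leRHS](bigD1 i)//= addrCA lerDl addr_ge0// sumr_ge0// => k _.
  by rewrite sumr_ge0.
- move=> t b b0 tb.
  apply: (@le_trans _ _ (\sum_(i < \dim V) b * enorm (Y`_i))).
    elim/big_rec2: _ => [|i y1 y2 _ IH]; first by rewrite enorm0.
    apply: le_trans (enorm_triangle _ _) _; rewrite lerD// enormZ.
    by rewrite ler_wpM2r ?enorm_ge0.
  by rewrite -mulr_sumr mulrC ler_wpM2r// lerDr.
Qed.

Local Open Scope ereal_scope.

Lemma hausdorff_pre_le_seq d (A : set 'rV[R]_N) (s : seq (set 'rV[R]_N)) :
  (0 <= d)%R ->
  (forall F, F \in s -> forall x y, F x -> F y -> (enorm (x - y) <= d)%R) ->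
  (forall x, A x -> exists2 F, F \in s & F x) ->
  hausdorff_pre n d A <= ((size s)%:R * d ^+ n)%:E.
Proof.
move=> d0 sd As; pose F i := nth set0 s i.
have Fd i x y : F i x -> F i y -> (enorm (x - y) <= d)%R.
  have [ilt|ige] := ltnP i (size s); first by apply: sd; exact: mem_nth.
  by rewrite /F nth_default.
apply: (@le_trans _ _ (\sum_(i <oo) diam_gauge n (F i))).
  apply: ereal_inf_lbound; exists F => //; split=> [i|x Ax].
    by apply: ediam_le => x y; exact: Fd.
  by have [_ /(nthP set0)[i _ <-] Gx] := As _ Ax; exists i.
rewrite (nneseries_split 0 (size s)); last by move=> *; exact: diam_gauge_ge0.
rewrite add0n [X in _ + X]eseries0 ?adde0; last first.
  by move=> i ige _; rewrite /F nth_default// diam_gauge0.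
apply: (@le_trans _ _ (\sum_(0 <= i < size s) (d ^+ n)%:E)).
  by apply: lee_sum => i _; apply: diam_gauge_le => // x y; exact: Fd.
by rewrite sumEFin big_const_nat subn0 iter_addr_0 mulr_natl.
Qed.

(** In coordinates, [M ^ n] cells of width [w = 2 * B / M] cover the ball; their
    diameters are at most [A * w], so the sum of their gauges is at most
    [(2 * A * B) ^ n] for every [M]. *)
Lemma hball_lty : hball n V < +oo.
Proof.
have [X [co [A [B [A0 B0 _ [coV _ coB coN XA]]]]]] := vspace_coordinates.
apply: (@le_lt_trans _ _ ((2 * A * B) ^+ n)%:E); last by rewrite ltry.
apply: ge_ereal_sup => _ [d /= d0 <-].
(* a number of cells per edge which makes their diameters at most [d] *)
pose M := (Num.truncn (2 * A * B / d)).+1.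
have M0 : (0 < M%:R :> R)%R by rewrite ltr0n.
have Md : (2 * A * B / M%:R <= d)%R.
  by rewrite ler_pdivrMr// [leRHS]mulrC -ler_pdivrMr// ltW// truncnS_gt.
pose w := (2 * B / M%:R)%R.
have w0 : (0 < w)%R by rewrite divr_gt0// mulr_gt0.
pose Q (f : {ffun 'I_n -> 'I_M}) : set 'rV[R]_N :=
  [set v | v \in V /\ forall i, (w * (f i)%:R <= co i v + B <= w * (f i).+1%:R)%R].
pose s := [seq Q f | f <- enum {: {ffun 'I_n -> 'I_M}}].
have e0 : (0 <= 2 * A * B / M%:R)%R by rewrite ltW// divr_gt0// !mulr_gt0.
apply: (@le_trans _ _ (hausdorff_pre n (2 * A * B / M%:R) ([set` V] `&` eball 0%R 1%R))).
  apply: le_ereal_inf_tmp => _ [F [FM VF] <-].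
  apply: ereal_inf_lbound; exists F => //; split => // i.
  by rewrite (le_trans (FM i))// lee_fin.
apply: le_trans (hausdorff_pre_le_seq e0 (s := s) _ _) _.
- move=> _ /mapP[f _ ->] x y [Vx fx] [Vy fy].
  have -> : (x - y = \sum_i co i (x - y) *: X i)%R by apply: coV; rewrite rpredB.
  have -> : (2 * A * B / M%:R = A * w)%R by rewrite /w; ring.
  apply: XA => [|i]; first exact: ltW.
  rewrite coB ler_norml; have := fx i; have := fy i.
  by rewrite -natr1 => /andP[? ?] /andP[? ?]; apply/andP; split; lra.
- move=> x [Vx]; rewrite /eball /= subr0 => x1.
  have cow i : (0 <= (co i x + B) / w < M%:R)%R.
    have : (`|co i x| < B)%R.
      by apply: le_lt_trans (coN _ _) _; rewrite gtr_pMr.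
    rewrite ltr_norml => /andP[Bco coB'].
    rewrite divr_ge0 ?(ltW w0)//; last by lra.
    rewrite ltr_pdivrMr// /w mulrC mulfVK ?gt_eqF//; lra.
  exists (Q [ffun i => inord (Num.truncn ((co i x + B) / w))]).
    by apply/mapP; eexists; [rewrite mem_enum|].
  split=> // i; rewrite ffunE inordK; last first.
    by have /andP[? ?] := cow i; rewrite ltnS -ltnS truncn_lt_nat.
  have /andP[c0 _] := cow i.
  apply/andP; split; rewrite mulrC; first by rewrite -ler_pdivlMr// truncn_le.
  by rewrite -ler_pdivrMr// ltW// truncnS_gt.
rewrite lee_fin size_map -cardE card_ffun !card_ord natrX -exprMn.
by rewrite [X in (X ^+ n)%R](_ : _ = 2 * A * B)%R// mulrC mulfVK// gt_eqF.
Qed.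

End basis_bounds.

Lemma exists_larger_pow {R : realType} (n : nat) (D e : R) : 0 < e ->
  exists2 d, D < d & d ^+ n <= D ^+ n + e.
Proof.
move=> e0; have De : D ^+ n < D ^+ n + e by rewrite ltrDl.
have [r /= r0 Dr] := (nbhs_ballP _ _).1 (cvgr_lt _ (@exprn_continuous R n D) _ De).
exists (D + r / 2); first by rewrite ltrDl divr_gt0.
apply/ltW/Dr; rewrite /ball /= opprD addNKr normrN gtr0_norm ?divr_gt0//.
by move: r0; lra.
Qed.

Section hball_positive.
Context {R : realType} {N : nat}.
Variables (n : nat) (V : {vspace 'rV[R]_N}) (dimV : \dim V = n).
Local Open Scope ereal_scope.

(** Slightly enlarged, the sets of a cover become open, so finitely many of them
    cover a cube of [V]; counting the points of a fine grid in each of them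
    bounds the sum of their diameters from below. *)
Lemma hball_gt0 : (0 < n)%N -> 0 < hball n V.
Proof.
move=> n0.
have [X [co [A [B [A0 B0 XV [coV coX coB coN XA]]]]]] := vspace_coordinates dimV.
(* the points of [V] with coordinates at most [tau] are in the unit ball *)
pose tau := ((2 * A)^-1)%R.
have tau0 : (0 < tau)%R by rewrite invr_gt0 mulr_gt0.
pose kap := ((tau / (2 * B)) ^+ n / 2)%R.
have kap0 : (0 < kap)%R by rewrite divr_gt0// exprn_gt0// divr_gt0// mulr_gt0.
suff : kap%:E <= hausdorff_pre n 1 ([set` V] `&` eball 0%R 1%R).
  move=> kapH; apply: (@lt_le_trans _ _ kap%:E); first by rewrite lte_fin.
  by apply: le_trans kapH _; exact: hausdorff_pre_le.
apply: le_ereal_inf_tmp => _ [F [F1 VF] <-]; rewrite leNgt; apply/negP => Fkap.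
pose e i := (kap / (2 ^ i.+1)%:R)%R.
have e0 i : (0 < e i)%R by rewrite divr_gt0// ltr0n expn_gt0.
(* [de.1] exceeds the diameter of [F i] enough for an enlargement by [de.2] *)
have dP i : exists de : R * R, [/\ (0 < de.1)%R, (0 < de.2)%R,
    (forall x y, F i x -> F i y -> enorm (x - y) + 2 * de.2 <= de.1)%R &
    (de.1 ^+ n)%:E <= diam_gauge n (F i) + (e i)%:E].
  have [F0|/set0P F0] := eqVneq (F i) set0.
    have [d d0 dn] := exists_larger_pow n 0%R (e0 i).
    exists (d, 1)%R; split => //=; first by move=> x y; rewrite F0.
    by rewrite F0 diam_gauge0 add0e lee_fin; rewrite expr0n gtn_eqF// add0r in dn.
  have [D [D0 FD ->]] := diam_gaugeE n F0 (F1 i).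
  have [d Dd dn] := exists_larger_pow n D (e0 i).
  exists (d, (d - D) / 2)%R; split => //=; first exact: le_lt_trans Dd.
  + by rewrite divr_gt0// subr_gt0.
  + move=> x y Fx Fy; have := enorm_le_ediam FD Fx Fy; lra.
have {dP}[de deP] := choice dP.
pose d i := (de i).1; pose eta i := (de i).2.
have d0 i : (0 < d i)%R by have [] := deP i.
pose L (t : 'rV[R]_n) : 'rV[R]_N := (\sum_j t 0 j *: X j)%R.
have LB t u : (L t - L u = \sum_j (t 0 j - u 0 j) *: X j)%R.
  by rewrite /L -sumrB; apply: eq_bigr => j _; rewrite scalerBl.
have LA t u : (enorm (L t - L u) <= A * `|t - u|)%R.
  by rewrite LB; apply: XA => // j; have := coord_le_norm (t - u) j; rewrite !mxE.
pose U i : set 'rV[R]_n := [set t | exists2 x, F i x & enorm (L t - x) < eta i]%R.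
have openU i : open (U i).
  rewrite openE => t [x Fx tx]; apply/nbhs_ballP.
  exists ((eta i - enorm (L t - x)) / A)%R => /=; first by rewrite divr_gt0// subr_gt0.
  move=> u; rewrite -ball_normE /= ltr_pdivlMr// mulrC => tu; exists x => //.
  have := LA t u; rewrite enormB => ltu.
  by have := enorm_triangleB (L u) (L t) x; move: tu ltu; lra.
pose K : set 'rV[R]_n := closed_ball (0%R : 'rV[R]_n) tau.
have Kcompact : compact K.
  apply: bounded_closed_compact; last exact: closed_ball_closed.
  exists tau; split; first exact: num_real.
  move=> M tauM t; rewrite /K closed_ballE// /closed_ball_ /= sub0r normrN.
  by move=> /le_trans; apply; exact: ltW.
have KU : K `<=` cover setT U.
  move=> t; rewrite /K closed_ballE// /closed_ball_ /= sub0r normrN => ttau.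
  have : ([set` V] `&` eball 0%R 1%R) (L t).
    split; first by rewrite /= rpred_sum// => j _; rewrite rpredZ.
    rewrite /eball /= subr0; apply: (@le_lt_trans _ _ (A * tau)%R).
      by apply: XA => [|j]; [exact: ltW|exact: le_trans (coord_le_norm _ _) ttau].
    by rewrite /tau invfM mulrCA divff ?gt_eqF// mulr1 invf_lt1// ltr1n.
  move=> /VF[i _ Fi]; exists i => //; exists (L t) => //.
  by rewrite subrr enorm0; have [] := deP i.
move: Kcompact; rewrite compact_cover => /(_ _ setT U (fun i _ => openU i) KU).
move=> [I _ KI].
(* a mesh so fine that each of the finitely many sets is wider than it *)
pose M := (Num.truncn (\sum_(i <- I) tau / (B * d i))%R).+1.
have Bd0 i : (0 < tau / (B * d i))%R by rewrite divr_gt0// mulr_gt0.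
have M0 : (0 < M%:R :> R)%R by rewrite ltr0n.
have IM i : i \in I -> (tau / (B * d i) <= M%:R)%R.
  move=> iI; apply: ltW; apply: le_lt_trans _ (truncnS_gt _).
  by rewrite (big_fsetD1 i)//= lerDl sumr_ge0// => j _; exact: ltW.
pose T (f : {ffun 'I_n -> 'I_M}) : 'rV[R]_n := (\row_j (tau * (f j)%:R / M%:R))%R.
have TK f : K (T f).
  rewrite /K closed_ballE// /closed_ball_ /= sub0r normrN.
  rewrite /Num.Def.normr/= mx_normrE; apply/bigmax_leP; split; first exact: ltW.
  move=> [i j] _ /=; rewrite mxE ger0_norm; last first.
    by rewrite divr_ge0// mulr_ge0// ltW.
  by rewrite ler_pdivrMr// ler_pM2l// ler_nat ltnW.
pose S i : {set {ffun 'I_n -> 'I_M}} := finset (fun f => `[< U i (T f) >]).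
have Scard i : i \in I -> (#|S i|%:R <= (2 * (B * d i) * M%:R / tau) ^+ n)%R.
  move=> iI; pose k := Num.truncn (B * d i * M%:R / tau)%R.
  have Bd : (0 <= B * d i * M%:R / tau)%R by rewrite divr_ge0 ?mulr_ge0 ?ltW.
  apply: (@le_trans _ _ ((k.+1 ^ n)%:R)%R).
    rewrite ler_nat; apply: card_grid_le => f g.
    rewrite !inE => -[x Fx fx] [y Fy gy] j.
    rewrite -leq_subLR truncn_ge_nat//.
    have [fg|/ltnW gf] := leqP (f j) (g j).
      by move: fg; rewrite -subn_eq0 => /eqP ->.
    rewrite natrB// ler_pdivlMr// -ler_pdivrMr//.
    have := coN j (L (T f) - L (T g))%R.
    have -> : (co j (L (T f) - L (T g)) = ((f j)%:R - (g j)%:R) * tau / M%:R)%R.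
      by rewrite LB coX !mxE; ring.
    move=> /(le_trans (ler_norm _)) /le_trans; apply; rewrite ler_pM2l//.
    have [_ _ /(_ _ _ Fx Fy) + _] := deP i; rewrite -/(d i) -/(eta i).
    have := enorm_triangleB (L (T f)) x (L (T g)).
    have := enorm_triangleB x y (L (T g)); rewrite (enormB y).
    by move: fx gy; lra.
  rewrite natrX; apply: lerXn2r; rewrite ?nnegrE//.
    by rewrite divr_ge0 ?mulr_ge0 ?ltW.
  have := IM _ iI; rewrite ler_pdivrMr ?mulr_gt0// => h.
  have h1 : (1 <= B * d i * M%:R / tau)%R by rewrite ler_pdivlMr// mul1r mulrC.
  have -> : (2 * (B * d i) * M%:R / tau = B * d i * M%:R / tau + B * d i * M%:R / tau)%R by ring.
  by rewrite -natr1 lerD// truncn_le.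
have count : ((M ^ n)%:R <= \sum_(i <- I) #|S i|%:R :> R)%R.
  rewrite -natr_sum ler_nat.
  have <- : #|{ffun 'I_n -> 'I_M}| = (M ^ n)%N by rewrite card_ffun !card_ord.
  rewrite -sum1_card; under [leqRHS]eq_bigr do rewrite -sum1_card big_mkcond.
  rewrite exchange_big /=; apply: leq_sum => f _.
  have [i iI Ui] := KI _ (TK f); rewrite (big_fsetD1 i)//= inE ifT ?leq_addr//.
  exact/asboolP.
have sumd : (\sum_(i <- I) (d i ^+ n)%:E < (kap + kap)%:E).
  apply: (@le_lt_trans _ _ (\sum_(i <oo) (diam_gauge n (F i) + (e i)%:E))).
    apply: (@le_trans _ _ (\sum_(i <- I) (diam_gauge n (F i) + (e i)%:E))).
      by apply: lee_sum => i _; have [] := deP i.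
    apply: (@lee_sum_fset_lim R _ I xpredT) => i _; rewrite adde_ge0 ?diam_gauge_ge0//.
    by rewrite lee_fin ltW.
  apply: le_lt_trans (epsilon_trick _ _ _) _.
  - by move=> i; exact: diam_gauge_ge0.
  - exact: ltW.
  - by rewrite EFinD lte_leD.
move: sumd; rewrite sumEFin lte_fin /kap -mulrDr.
have -> : (2^-1 + 2^-1 = 1 :> R)%R by lra.
rewrite mulr1 ltNge => /negP; apply.
have Mn0 : (0 < (2 * B * M%:R / tau) ^+ n)%R by rewrite exprn_gt0// divr_gt0 ?mulr_gt0.
rewrite -(ler_pM2l Mn0) mulr_sumr -exprMn.
have -> : (2 * B * M%:R / tau * (tau / (2 * B)) = M%:R)%R.
  by field; rewrite !gt_eqF.
rewrite -natrX; apply: le_trans count _.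
rewrite big_seq [leRHS]big_seq; apply: ler_sum => i iI; apply: le_trans (Scard _ iI) _.
by rewrite -exprMn le_eqVlt; apply/orP; left; apply/eqP; congr (_ ^+ _)%R; ring.
Qed.

Lemma hball_fin_num : hball n V \is a fin_num.
Proof. by rewrite ge0_fin_numE ?hball_ge0// hball_lty. Qed.

(** A set of diameter [D] with a point in [V] meets [V] within a ball centred at
    that point, of radius as close to [D] as desired, hence of measure at most
    [D ^ n * hball n V] in the limit. Summing over a cover of the unit ball and
    dividing by [hball n V], the total gauge of the cover is at least 1. *)
Lemma hball_ge1 : (0 < n)%N -> 1 <= hball n V.
Proof.
move=> n0; have hE := fineK hball_fin_num; set h := fine _ in hE.
have h0 : (0 < h)%R by rewrite -lte_fin hE hball_gt0.
apply: le_trans (hausdorff_pre_le n _ (@ltr01 R)).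
apply: le_ereal_inf_tmp => _ [F [F1 VF] <-].
have HF i : hausdorff n ([set` V] `&` eball 0%R 1%R `&` F i) <= h%:E * diam_gauge n (F i).
  have [->|/set0P[x [[Vx _] Fx]]] := eqVneq ([set` V] `&` eball 0%R 1%R `&` F i) set0.
    by rewrite hausdorff0 mule_ge0 ?diam_gauge_ge0// lee_fin ltW.
  have F0 : F i !=set0 by exists x.
  have [D [D0 FD ->]] := diam_gaugeE n F0 (F1 i).
  apply/lee_addgt0Pr => e e0.
  have [d Dd dn] := exists_larger_pow n D (divr_gt0 e0 h0).
  apply: (@le_trans _ _ ((d ^+ n)%:E * hball n V)).
    rewrite -(hausdorff_eball n Vx (le_lt_trans D0 Dd)); apply: le_hausdorff.
    move=> y [[Vy _] Fy]; split => //; apply: le_lt_trans Dd.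
    exact: enorm_le_ediam FD _ _.
  rewrite -hE -!EFinM -EFinD lee_fin.
  have -> : (h * D ^+ n + e = (D ^+ n + e / h) * h)%R by field; rewrite gt_eqF.
  by rewrite ler_pM2r.
rewrite -(@lee_pmul2l _ h%:E)// ?lte_fin// mule1 -nneseriesZl; last first.
  by move=> i _; exact: diam_gauge_ge0.
apply: (@le_trans _ _ (\sum_(i <oo) hausdorff n ([set` V] `&` eball 0%R 1%R `&` F i))).
  rewrite hE; apply: le_trans (hausdorff_sigma_subadditive _ _).
  by apply: le_hausdorff => x Vx; have [i _ Fx] := VF _ Vx; exists i.
by apply: lee_nneseries => i _ //; move=> _; exact: hausdorff_ge0.
Qed.

End hball_positive.

(** * Integrals of powers of the norm over subspaces *)

Section power_estimates.
Context {R : realType}.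
Implicit Types (a b q r s t : R) (n : nat).

(** From [1 - z <= expR (- z)] at [z = a * ln t], and [ln t <= t - 1]. *)
Lemma powR_sub1_le a t : 0 < a -> 1 < t -> t `^ a - 1 <= a * (t - 1) * t `^ a.
Proof.
move=> a0 t1; have t0 : 0 < t by lra.
have tE : t `^ a = expR (a * ln t) by rewrite mulrC expRM lnK ?posrE.
have lnt : ln t <= t - 1.
  by have /le_ln1Dx : -1 < t - 1 by [lra]; rewrite addrC subrK.
have := expR_ge1Dx (- (a * ln t)); rewrite expRN -tE => h.
have ta0 : 0 < t `^ a by rewrite powR_gt0.
have : t `^ a * (1 - a * ln t) <= 1.
  by rewrite -ler_pdivlMl// mulr1.
have : a * ln t * t `^ a <= a * (t - 1) * t `^ a by rewrite ler_pM2r// ler_pM2l.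
by lra.
Qed.

Lemma powR_gt1 a t : 0 < a -> 1 < t -> 1 < t `^ a.
Proof.
move=> a0 t1; have := @gt0_ltr_powR _ _ a0 1 t.
by rewrite powR1 !nnegrE => /(_ ler01 (ltW (lt_trans ltr01 t1)) t1).
Qed.

Lemma nneseries_geometric c q : 0 <= c -> 0 < q < 1 ->
  (\sum_(j <oo) (c * q ^+ j)%:E)%E = (c / (1 - q))%:E.
Proof.
move=> c0 /andP[q0 q1]; apply/cvg_lim => //.
have -> : (fun n => \sum_(0 <= j < n) (c * q ^+ j)%:E)%E = EFin \o series (geometric c q).
  by apply/funext => n; rewrite /= sumEFin.
apply: cvg_EFin; first exact: nearW.
by apply: cvg_geometric_series; rewrite gtr0_norm.
Qed.

Lemma expr_lt_small q e : 0 < q < 1 -> 0 < e -> exists k, q ^+ k < e.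
Proof.
move=> /andP[q0 q1] e0; have q1' : `|q| < 1 by rewrite gtr0_norm.
have [k _ qk] := cvgr_lt _ (cvg_expr q1') _ e0.
by exists k; exact: (qk k (leqnn k)).
Qed.

Lemma powR_geometric r t x j : 0 <= r -> 0 <= t ->
  (r * t ^+ j) `^ x = r `^ x * (t `^ x) ^+ j.
Proof.
move=> r0 t0; rewrite powRM ?exprn_ge0//; congr (_ * _).
by rewrite -(powR_mulrn _ t0) -(powR_mulrn _ (powR_ge0 t x)) -!powRrM mulrC.
Qed.

End power_estimates.

Section kernel_integrals.
Context {R : realType} {N : nat}.
Variables (n : nat) (V : {vspace 'rV[R]_N}) (dimV : \dim V = n) (n0 : (0 < n)%N).
Variables (s : R) (s01 : 0 < s < 1).
Let T := Defs.hausdorff_space R N n.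
Let mu := hausdorff_measure R N n.
Let h := fine (hball n V).
Let p := n%:R + 2 * s.

Let hE : h%:E = hball n V.
Proof. by rewrite fineK// hball_fin_num. Qed.

Let h1 : 1 <= h.
Proof. by rewrite -lee_fin hE hball_ge1. Qed.

(** [V] is the zero set of the Lipschitz function [|x - projv V x|]. *)
Lemma measurable_vspace m : measurable ([set` V] : set (Defs.hausdorff_space R N m)).
Proof.
pose g (x : 'rV[R]_N) := enorm (x - projv V x).
pose K := 1 + \sum_(j < N) enorm (projv V (delta_mx 0 j)).
have projK x : enorm (projv V x) <= (K - 1) * enorm x.
  rewrite {1}(row_sum_delta x) linear_sum /K addrAC subrr add0r mulr_suml.
  elim/big_rec2: _ => [|i y1 y2 _ IH]; first by rewrite enorm0.
  apply: le_trans (enorm_triangle _ _) _; rewrite lerD//.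
  by rewrite linearZ enormZ mulrC ler_wpM2l ?enorm_ge0// coord_le_enorm.
have gK x y : `|g x - g y| <= K * enorm (x - y).
  apply: le_trans (enorm_lip _ _) _.
  have -> : x - projv V x - (y - projv V y) = (x - y) - projv V (x - y).
    by rewrite (linearB (projv V)) !opprB [projv V y - y]addrC addrACA [- _ + _]addrC.
  apply: le_trans (enorm_triangle _ _) _; rewrite enormN.
  by have := projK (x - y); lra.
have mg := lipschitz_measurable (n := m) gK.
have -> : [set` V] = setT `&` g @^-1` [set 0].
  rewrite setTI; apply/seteqP; split => x /=; rewrite /g.
    by move=> xV; rewrite projv_id// subrr enorm0.
  by move/enorm0_eq0/eqP; rewrite subr_eq0 => /eqP ->; rewrite memv_proj.
by apply: mg => //.
Qed.

Lemma measurable_enorm m (D : set (Defs.hausdorff_space R N m)) :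
  measurable_fun D (enorm : Defs.hausdorff_space R N m -> R).
Proof.
apply: measurable_funTS; apply: (@lipschitz_measurable _ _ m _ 1) => x y.
by rewrite mul1r enorm_lip.
Qed.

Lemma measurable_eball0 m r : measurable (eball 0 r : set (Defs.hausdorff_space R N m)).
Proof.
have -> : eball 0 r = setT `&` enorm @^-1` `]-oo, r[ :> set 'rV[R]_N.
  by rewrite setTI; apply/seteqP; split => x /=; rewrite /eball /= subr0 in_itv.
by apply: (@measurable_enorm m setT).
Qed.

Definition annulus (a b : R) : set 'rV[R]_N :=
  [set` V] `&` (eball 0 b `\` eball 0 a).

Lemma annulusP a b z : annulus a b z <-> [/\ z \in V, a <= enorm z & enorm z < b].
Proof.
rewrite /annulus /eball /= !subr0; split=> [[? [? /negP]]|[? ? ?]].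
  by rewrite -leNgt.
by split => //; split => //; apply/negP; rewrite -leNgt.
Qed.

Lemma measurable_annulus m a b : measurable (annulus a b : set (Defs.hausdorff_space R N m)).
Proof.
apply: measurableI; first exact: measurable_vspace.
by apply: measurableD; exact: measurable_eball0.
Qed.

Lemma measure_annulus a b : 0 < a -> a <= b ->
  mu (annulus a b) = ((b ^+ n - a ^+ n) * h)%:E.
Proof.
move=> a0 ab; have b0 := lt_le_trans a0 ab.
have Hb c : 0 < c -> mu ([set` V] `&` eball 0 c) = (c ^+ n * h)%:E.
  by move=> c0; rewrite EFinM hE; apply: hausdorff_eball => //; exact: mem0v.
have -> : annulus a b = ([set` V] `&` eball 0 b) `\` ([set` V] `&` eball 0 a).
  apply/seteqP; split => z; first by move=> [Vz [zb za]]; split => // -[].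
  by move=> [[Vz zb] za]; split => //; split => // za'; apply: za.
have mVb c : measurable ([set` V] `&` eball 0 c : set T).
  by apply: measurableI; [exact: measurable_vspace|exact: measurable_eball0].
have fin : (mu ([set` V] `&` eball 0 b) < +oo)%E by rewrite Hb// ltry.
transitivity (mu ([set` V] `&` eball 0 b) -
    mu ([set` V] `&` eball 0 b `&` ([set` V] `&` eball 0 a)))%E.
  by apply: measureD.
have -> : [set` V] `&` eball 0 b `&` ([set` V] `&` eball 0 a) = [set` V] `&` eball 0 a.
  apply/seteqP; split => z; first by move=> [].
  move=> [Vz za]; split => //; split => //; exact: lt_le_trans ab.
by rewrite !Hb// -EFinB -mulrBl.
Qed.

Let kernel (z : 'rV[R]_N) := (enorm z `^ p)^-1.

Lemma measurable_powR_enorm (D : set T) (b : R) :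
  measurable_fun D (fun z : T => enorm z `^ b).
Proof.
have m1 : measurable_fun setT ((@powR R)^~ b) by exact: measurable_powR.
by apply: (measurableT_comp m1); exact: measurable_enorm.
Qed.

Lemma measurable_kernel (D : set T) : measurable_fun D (kernel : T -> R).
Proof.
rewrite /kernel; under eq_fun do rewrite -powRN.
exact: measurable_powR_enorm.
Qed.

Let s0 : 0 < s. Proof. by case/andP: s01. Qed.
Let s1 : s < 1. Proof. by case/andP: s01. Qed.
Let p0 : 0 <= p. Proof. by rewrite /p addr_ge0// mulr_ge0// ltW. Qed.

Let kernel_powR a : 0 < a -> (a `^ p)^-1 * a ^+ n = a `^ (- (2 * s)).
Proof.
move=> a0; rewrite /p powRD; last by rewrite (gt_eqF a0) implybT.
rewrite powR_mulrn ?ltW// powRN; field.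
by rewrite !gt_eqF ?powR_gt0// exprn_gt0.
Qed.

Lemma integral_kernel_annulus a b : 0 < a -> a <= b ->
  (((b `^ p)^-1 * ((b ^+ n - a ^+ n) * h))%:E
    <= \int[mu]_(z in annulus a b) (kernel z)%:E
    <= ((a `^ p)^-1 * ((b ^+ n - a ^+ n) * h))%:E)%E.
Proof.
move=> a0 ab; have b0 := lt_le_trans a0 ab.
have mk : measurable_fun (annulus a b : set T) (EFin \o (kernel : T -> R)).
  by apply/measurable_EFinP; exact: measurable_kernel.
rewrite (EFinM (_^-1)) -measure_annulus// -integral_cst; last exact: measurable_annulus.
rewrite (EFinM (_^-1)) -measure_annulus// -integral_cst; last exact: measurable_annulus.
have mc c : measurable_fun (annulus a b : set T) (cst c : T -> \bar R).
  exact: measurable_cst.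
apply/andP; split; (apply: ge0_le_integral; [|move=> z _| | |]).
- exact: measurable_annulus.
- by rewrite lee_fin invr_ge0 powR_ge0.
- exact: mc.
- exact: mk.
- move=> z /annulusP[_ az zb]; have z0 := lt_le_trans a0 az.
  rewrite lee_fin lef_pV2 ?posrE ?powR_gt0//.
  by apply: ge0_ler_powR; rewrite ?nnegrE ?(ltW z0) ?(ltW b0) ?(ltW zb).
- exact: measurable_annulus.
- by rewrite lee_fin /kernel invr_ge0 powR_ge0.
- exact: mk.
- exact: mc.
- move=> z /annulusP[_ az zb]; have z0 := lt_le_trans a0 az.
  rewrite lee_fin lef_pV2 ?posrE ?powR_gt0//.
  by apply: ge0_ler_powR; rewrite ?nnegrE ?(ltW z0) ?(ltW a0).
Qed.

Lemma tail_annuli r t : 0 < r -> 1 < t ->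
  [set` V] `\` eball 0 r = \bigcup_j annulus (r * t ^+ j) (r * t ^+ j.+1).
Proof.
move=> r0 t1; have t0 : 0 < t by lra.
apply/seteqP; split => z.
  rewrite /eball /= subr0 => -[Vz /negP]; rewrite -leNgt => rz.
  have z0 := lt_le_trans r0 rz.
  have ex : exists k, enorm z < r * t ^+ k.
    have [|k tk] := @expr_lt_small _ (t^-1) (r / enorm z) _ (divr_gt0 r0 z0).
      by rewrite invr_gt0 t0 invf_lt1.
    exists k; move: tk; rewrite exprVn ltr_pdivlMr// mulrC ltr_pdivrMr//.
    by rewrite exprn_gt0.
  have [[|k] kz kmin] := ex_minnP ex; first by move: kz; rewrite expr0 mulr1 ltNge rz.
  exists k => //; apply/annulusP; split => //.
  by rewrite leNgt; apply/negP => /kmin; rewrite ltnn.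
move=> [j _ /annulusP[Vz jz _]]; split => //.
rewrite /eball /= subr0; apply/negP; rewrite -leNgt; apply: le_trans jz.
by rewrite ler_peMr ?(ltW r0)// exprn_ege1// ltW.
Qed.

Lemma trivIset_tail r t : 0 < r -> 1 < t ->
  trivIset setT (fun j => annulus (r * t ^+ j) (r * t ^+ j.+1)).
Proof.
move=> r0 t1; apply: ltn_trivIset => j i ij; apply/seteqP; split => // z.
move=> [/annulusP[_ _ zi] /annulusP[_ zj _]].
have := lt_le_trans zi (le_trans _ zj); rewrite ltxx => H; exfalso.
suff : false by []; apply: H.
by rewrite ler_pM2l// ler_eXn2l.
Qed.

Lemma integral_tail_series r t : 0 < r -> 1 < t ->
  (\int[mu]_(z in [set` V] `\` eball 0 r) (kernel z)%:E =
   \sum_(j <oo) \int[mu]_(z in annulus (r * t ^+ j) (r * t ^+ j.+1)) (kernel z)%:E)%E.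
Proof.
move=> r0 t1; rewrite (tail_annuli r0 t1).
apply: (@ge0_integral_bigcup _ _ _ mu).
- by move=> k; exact: measurable_annulus.
- by apply/measurable_EFinP; exact: measurable_kernel.
- by move=> z _; rewrite lee_fin /kernel invr_ge0 powR_ge0.
- exact: trivIset_tail.
Qed.

(** Over dyadic annuli, the integrals form a series dominated by a geometric one of
    ratio [2 ^ - (2 s)]. *)
Lemma tail_kernel_lty r : 0 < r ->
  (\int[mu]_(z in [set` V] `\` eball 0 r) (kernel z)%:E < +oo)%E.
Proof.
move=> r0; rewrite (integral_tail_series r0 (ltr1n R 2))//.
pose q : R := 2 `^ (- (2 * s)).
have q01 : 0 < q < 1.
  rewrite /q powR_gt0//= powRN invf_lt1 ?powR_gt0//.
  by rewrite powR_gt1 ?ltr1n// mulr_gt0.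
pose c := r `^ (- (2 * s)) * (2 ^+ n - 1) * h.
have c0 : 0 <= c.
  by rewrite !mulr_ge0 ?powR_ge0 ?subr_ge0 ?exprn_ege1 ?ler1n// (le_trans ler01).
apply: (@le_lt_trans _ _ (\sum_(j <oo) (c * q ^+ j)%:E)%E); last first.
  by rewrite nneseries_geometric// ltry.
apply: lee_nneseries => j _.
  by move=> _; apply: integral_ge0 => z _; rewrite lee_fin /kernel invr_ge0 powR_ge0.
have rj0 : 0 < r * 2 ^+ j by rewrite mulr_gt0// exprn_gt0.
have rj : r * 2 ^+ j <= r * 2 ^+ j.+1 by rewrite ler_pM2l// ler_eXn2l ?ltr1n.
have /andP[_ /le_trans] := integral_kernel_annulus rj0 rj; apply.
rewrite lee_fin exprSr mulrA exprMn -[X in _ - X]mulr1 -mulrBr.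
rewrite -!mulrA [_^-1 * _]mulrA kernel_powR// powR_geometric// ?(ltW r0)//.
by rewrite /c /q le_eqVlt; apply/orP; left; apply/eqP; ring.
Qed.

(** Bounding the kernel by its infimum on each of the annuli
    [r t^j <= |z| < r t^(j+1)] leads to a geometric series. By [powR_sub1_le], its
    sum is within a factor [t ^ - (1 + 2 s)] of the bound, and this factor tends
    to 1 when [t] decreases to 1. *)
Lemma tail_kernel_ge r : 0 < r ->
  ((h * (r `^ (- (2 * s)) / (2 * s)))%:E <=
    \int[mu]_(z in [set` V] `\` eball 0 r) (kernel z)%:E)%E.
Proof.
move=> r0; have s20 : 0 < 2 * s by rewrite mulr_gt0.
have rs0 : 0 < r `^ (- (2 * s)) by rewrite powR_gt0.
have h0 : 0 < h by exact: lt_le_trans h1.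
apply/lee_mul01Pr => [|e /andP[e0 e1]].
  by rewrite lee_fin mulr_ge0 ?divr_ge0 ?ltW.
(* the ratio for which the factor lost is [e] *)
pose t := e^-1 `^ (1 + 2 * s)^-1.
have t1 : 1 < t by rewrite powR_gt1 ?invr_gt0 ?invf_gt1// addr_gt0.
have t0 : 0 < t := lt_trans ltr01 t1.
pose P := t `^ (2 * s).
have P1 : 1 < P by exact: powR_gt1.
have P0 : 0 < P := lt_trans ltr01 P1.
have tP : t * P = e^-1.
  rewrite /P -{1}(powRr1 (ltW t0)) -powRD; last by rewrite (gt_eqF t0) implybT.
  by rewrite /t -powRrM mulVf ?powRr1 ?invr_ge0 ?(ltW e0)// gt_eqF// addr_gt0.
have q01 : 0 < P^-1 < 1 by rewrite invr_gt0 P0 invf_lt1.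
have qE : t `^ (- (2 * s)) = P^-1 by rewrite powRN.
pose c := r `^ (- (2 * s)) * P^-1 * (1 - t ^- n) * h.
have tn : t ^- n <= t^-1.
  by rewrite lef_pV2 ?posrE ?exprn_gt0// -[leLHS]expr1 ler_eXn2l.
have t11 : t^-1 < 1 by rewrite invf_lt1.
have c0 : 0 <= c.
  by rewrite /c !mulr_ge0 ?(ltW h0) ?(ltW rs0) ?invr_ge0 ?(ltW P0)//; lra.
rewrite (integral_tail_series r0 t1).
apply: (@le_trans _ _ (\sum_(j <oo) (c * P^-1 ^+ j)%:E)%E).
  rewrite nneseries_geometric// -EFinM lee_fin /c.
  have -> : r `^ (- (2 * s)) * P^-1 * (1 - t ^- n) * h / (1 - P^-1) =
     h * r `^ (- (2 * s)) * ((1 - t ^- n) / (P - 1)).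
    by field; rewrite !gt_eqF ?subr_gt0 ?exprn_gt0.
  have -> : e * (h * (r `^ (- (2 * s)) / (2 * s))) =
     h * r `^ (- (2 * s)) * (e / (2 * s)) by field; rewrite gt_eqF.
  rewrite ler_pM2l ?mulr_gt0// ler_pdivlMr ?subr_gt0//.
  have -> : e = (t * P)^-1 by rewrite tP invrK.
  have PP := powR_sub1_le s20 t1; rewrite -/P in PP.
  apply: (@le_trans _ _ (1 - t^-1)); last by lra.
  have -> : 1 - t^-1 = (t * P)^-1 / (2 * s) * (2 * s * (t - 1) * P).
    by field; rewrite !gt_eqF.
  by rewrite ler_pM2l// divr_gt0// invr_gt0 mulr_gt0.
apply: lee_nneseries => j _.
  by move=> _; rewrite lee_fin mulr_ge0// exprn_ge0// invr_ge0 ltW.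
have rj0 : 0 < r * t ^+ j by rewrite mulr_gt0// exprn_gt0.
have rj1 : 0 < r * t ^+ j.+1 by rewrite mulr_gt0// exprn_gt0.
have rj : r * t ^+ j <= r * t ^+ j.+1 by rewrite ler_pM2l// ler_eXn2l.
have /andP[+ _] := integral_kernel_annulus rj0 rj; apply: le_trans.
rewrite lee_fin.
have -> : (r * t ^+ j.+1) ^+ n - (r * t ^+ j) ^+ n = (r * t ^+ j.+1) ^+ n * (1 - t ^- n).
  rewrite mulrBr mulr1 exprSr mulrA exprMn -!mulrA divff ?mulr1// gt_eqF//.
  by rewrite exprn_gt0.
rewrite -!mulrA [_^-1 * _]mulrA kernel_powR// powR_geometric// ?(ltW r0) ?(ltW t0)//.
by rewrite qE /c exprS le_eqVlt; apply/orP; left; apply/eqP; ring.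
Qed.

(** The sum of the geometric series that dominates the integrals of
    [|z| ^ (2 - n - 2 s)] over the dyadic annuli of the unit ball, relative to
    [hball n V]. *)
Definition near_constant : R :=
  (2 ^+ n - 1) * 2 `^ (2 * s) / (1 - (2^-1) `^ (2 - 2 * s)).

Lemma near_annuli rho t : 0 < rho -> 0 < t < 1 ->
  [set` V] `&` eball 0 rho `\ 0 = \bigcup_j annulus (rho * t ^+ j.+1) (rho * t ^+ j).
Proof.
move=> r0 t01; have /andP[t0 t1] := t01.
apply/seteqP; split => z.
  rewrite /eball /= subr0 => -[[Vz zr] /eqP z0].
  have {}z0 : 0 < enorm z.
    by rewrite lt_neqAle enorm_ge0 andbT eq_sym; apply: contra_neq z0; exact: enorm0_eq0.
  have ex : exists k, rho * t ^+ k <= enorm z.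
    have [k tk] := expr_lt_small t01 (divr_gt0 z0 r0).
    by exists k; rewrite mulrC -ler_pdivlMr// ltW.
  have [[|k] kz kmin] := ex_minnP ex; first by move: kz; rewrite expr0 mulr1 leNgt zr.
  exists k => //; apply/annulusP; split => //.
  by rewrite ltNge; apply/negP => /kmin; rewrite ltnn.
move=> [j _ /annulusP[Vz jz zj]]; rewrite /eball /= subr0; split.
  split => //; apply: lt_le_trans zj _.
  by rewrite ler_piMr ?(ltW r0)// exprn_ile1// ltW.
move=> z0; move: jz; rewrite z0 enorm0 leNgt => /negP; apply.
by rewrite mulr_gt0// exprn_gt0.
Qed.

Lemma trivIset_near rho t : 0 < rho -> 0 < t < 1 ->
  trivIset setT (fun j => annulus (rho * t ^+ j.+1) (rho * t ^+ j)).
Proof.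
move=> r0 /andP[t0 t1]; apply: ltn_trivIset => j i ij; apply/seteqP; split => // z.
move=> [/annulusP[_ zi _] /annulusP[_ _ zj]].
have := lt_le_trans zj (le_trans _ zi); rewrite ltxx => H; exfalso.
suff : false by []; apply: H.
by rewrite ler_pM2l// ler_wiXn2l// ltW.
Qed.

Let near_kernel (z : 'rV[R]_N) := enorm z ^+ 2 / enorm z `^ p.

Lemma measurable_near_kernel (D : set T) : measurable_fun D (near_kernel : T -> R).
Proof.
apply: measurable_funM; last exact: measurable_kernel.
by apply: measurable_funX; exact: measurable_enorm.
Qed.

(** Over the dyadic annuli of radii [rho / 2^j], the integrals form a series
    dominated by a geometric one of ratio [2 ^ - (2 - 2 s)]. *)
Lemma near_kernel_le eps rho : 0 < eps -> 0 < rho ->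
  (\int[mu]_(z in annulus eps rho) (near_kernel z)%:E <=
    (near_constant * rho `^ (2 - 2 * s) * h)%:E)%E.
Proof.
move=> e0 r0; have t01 : 0 < (2^-1 : R) < 1 by lra.
have mnk (D : set T) : measurable_fun D (EFin \o (near_kernel : T -> R)).
  by apply/measurable_EFinP; exact: measurable_near_kernel.
have nk0 z : 0 <= near_kernel z by rewrite divr_ge0 ?exprn_ge0 ?enorm_ge0 ?powR_ge0.
pose W : set T := ([set` V] `&` eball 0 rho) `\ (0 : 'rV[R]_N).
have sub : (\int[mu]_(z in annulus eps rho) (near_kernel z)%:E <=
            \int[mu]_(z in W) (near_kernel z)%:E)%E.
  apply: ge0_subset_integral; [| | |move=> z _|].
  - exact: measurable_annulus.
  - rewrite /W (near_annuli r0 t01); apply: bigcup_measurable => j _.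
    exact: measurable_annulus.
  - exact: mnk.
  - by rewrite lee_fin.
  - move=> z [Vz [zr ze]]; split => //= z0; apply: ze.
    by rewrite z0 /eball /= subr0 enorm0.
apply: le_trans sub _.
have -> : (\int[mu]_(z in W) (near_kernel z)%:E = \sum_(j <oo)
    \int[mu]_(z in annulus (rho * 2^-1 ^+ j.+1) (rho * 2^-1 ^+ j)) (near_kernel z)%:E)%E.
  rewrite /W (near_annuli r0 t01); apply: (@ge0_integral_bigcup _ _ _ mu).
  - by move=> k; exact: measurable_annulus.
  - exact: mnk.
  - by move=> z _; rewrite lee_fin.
  - exact: trivIset_near.
pose q := (2^-1 : R) `^ (2 - 2 * s).
have q01 : 0 < q < 1.
  have s2 : 0 < 2 - 2 * s by have := s1; lra.
  rewrite /q powR_gt0//= ?invr_gt0//.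
  have := @gt0_ltr_powR _ _ s2 (2^-1) 1; rewrite powR1 !nnegrE; apply => //; lra.
pose c := rho `^ (2 - 2 * s) * (2 ^+ n - 1) * 2 `^ (2 * s) * h.
have h0 : 0 <= h by exact: le_trans h1.
have c0 : 0 <= c.
  by rewrite /c !mulr_ge0 ?powR_ge0 ?subr_ge0 ?exprn_ege1 ?ler1n.
apply: (@le_trans _ _ (\sum_(j <oo) (c * q ^+ j)%:E)%E); last first.
  rewrite nneseries_geometric// lee_fin /c /near_constant -/q.
  by rewrite le_eqVlt; apply/orP; left; apply/eqP; ring.
apply: lee_nneseries => j _; first by move=> _; apply: integral_ge0 => z _; rewrite lee_fin.
set a := rho * _ ^+ j.+1; set b := rho * _ ^+ j.
have b0 : 0 < b by rewrite mulr_gt0// exprn_gt0.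
have ba : b = a * 2 by rewrite /a /b exprSr -!mulrA mulVf ?mulr1.
have a0 : 0 < a by rewrite mulr_gt0// exprn_gt0.
have ab : a <= b by lra.
have mk : measurable_fun (annulus a b : set T) (EFin \o (kernel : T -> R)).
  by apply/measurable_EFinP; exact: measurable_kernel.
apply: (@le_trans _ _ (\int[mu]_(z in annulus a b) ((b ^+ 2)%:E * (kernel z)%:E))%E).
  apply: ge0_le_integral; [|move=> z _| | |].
  - exact: measurable_annulus.
  - by rewrite lee_fin.
  - exact: mnk.
  - exact: (measurable_funeM _ mk).
  - move=> z /annulusP[_ _ zb]; rewrite -EFinM lee_fin ler_wpM2r ?invr_ge0 ?powR_ge0//.
    by rewrite lerXn2r ?nnegrE ?enorm_ge0 ?(ltW b0) ?(ltW zb).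
rewrite (ge0_integralZl _ _ mk); first last.
- by rewrite lee_fin exprn_ge0// ltW.
- by move=> z _; rewrite lee_fin /kernel invr_ge0 powR_ge0.
- exact: measurable_annulus.
apply: (@le_trans _ _ ((b ^+ 2)%:E * ((a `^ p)^-1 * ((b ^+ n - a ^+ n) * h))%:E)%E).
  apply: lee_wpmul2l; first by rewrite lee_fin exprn_ge0// ltW.
  by have /andP[_] := integral_kernel_annulus a0 ab.
rewrite -EFinM lee_fin.
have -> : b ^+ n - a ^+ n = a ^+ n * (2 ^+ n - 1) by rewrite ba [(a * 2) ^+ n]exprMn mulrBr mulr1.
rewrite -(mulrA (a ^+ n)) (mulrA _^-1) (kernel_powR a0).
have -> : a `^ (- (2 * s)) = b `^ (- (2 * s)) * 2 `^ (2 * s).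
  rewrite ba (@powRM _ a 2) ?(ltW a0)// -mulrA -powRD ?pnatr_eq0 ?implybT//.
  by rewrite addNr powRr0 mulr1.
have -> : b ^+ 2 * (b `^ (- (2 * s)) * 2 `^ (2 * s) * ((2 ^+ n - 1) * h)) =
  b `^ (2 - 2 * s) * (2 ^+ n - 1) * 2 `^ (2 * s) * h.
  rewrite powRD ?(gt_eqF b0) ?implybT// (powR_mulrn 2 (ltW b0)); ring.
rewrite powR_geometric ?(ltW r0) ?invr_ge0//.
by rewrite /c /q le_eqVlt; apply/orP; left; apply/eqP; ring.
Qed.

End kernel_integrals.

(** * Principal values of quadratic functions *)

Section principal_value.
Context {R : realType} {N : nat}.
Variables (n : nat) (V : {vspace 'rV[R]_N}) (dimV : \dim V = n) (n0 : (0 < n)%N).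
Variables (s : R) (s01 : 0 < s < 1).
Let T := Defs.hausdorff_space R N n.
Let mu := hausdorff_measure R N n.
Let h := fine (hball n V).
Let p := n%:R + 2 * s.

Lemma measurable_opp : measurable_fun setT ((fun z => - z) : T -> T).
Proof.
move=> _ A mA; rewrite setTI; apply: le_caratheodory_measurable => X /=.
have HN B : hausdorff_outer R N n (-%R @` B) = hausdorff_outer R N n B by exact: hausdorffN.
have imE B : X `&` (fun z => - z) @^-1` B = -%R @` ((-%R @` X) `&` B).
  apply/seteqP; split=> [x [Xx Bx]|_ [_ [[x Xx <-] Bx] <-]] /=.
    by exists (- x); [split => //; exact: imageP|rewrite opprK].
  by rewrite opprK.
rewrite imE preimage_setC imE !HN -[leRHS]HN.
by rewrite -(mA (-%R @` X)).
Qed.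

Lemma measurable_edot (w : 'rV[R]_N) (D : set T) : measurable_fun D (edot w : T -> R).
Proof.
apply: measurable_funTS; apply: (@lipschitz_measurable _ _ n _ (enorm w)) => x y.
rewrite -edotNr -edotDr ler_norml edot_le andbT lerNl -edotNr.
by apply: le_trans (edot_le _ _) _; rewrite enormN.
Qed.

Let odd_kernel w (z : 'rV[R]_N) := edot w z / enorm z `^ p.

Lemma measurable_odd_kernel w (D : set T) : measurable_fun D (odd_kernel w : T -> R).
Proof.
apply: measurable_funM; first exact: measurable_edot.
exact: measurable_kernel.
Qed.

Lemma annulus_lty a b : 0 < a -> (mu (annulus V a b) < +oo)%E.
Proof.
move=> a0; have [ab|ba] := leP a b; first by rewrite measure_annulus// ltry.
have -> : annulus V a b = set0.
  apply/seteqP; split => // z /annulusP[_ az zb].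
  by have := lt_trans (le_lt_trans az zb) ba; rewrite ltxx.
by rewrite measure0.
Qed.

Lemma integrable_annulus (f : 'rV[R]_N -> R) a b M : 0 < a ->
  measurable_fun (annulus V a b : set T) (f : T -> R) ->
  (forall z, annulus V a b z -> `|f z| <= M) ->
  mu.-integrable (annulus V a b) (EFin \o f).
Proof.
move=> a0 mf fM; apply: measurable_bounded_integrable; [| |exact: mf|].
- exact: measurable_annulus.
- exact: annulus_lty.
- exists M; split; first exact: num_real.
  by move=> K MK z Az; apply: le_trans (fM _ Az) (ltW MK).
Qed.

Lemma kernel_annulus_le a b z : 0 < a -> annulus V a b z ->
  (enorm z `^ p)^-1 <= (a `^ p)^-1.
Proof.
move=> a0 /annulusP[_ az zb]; have z0 := lt_le_trans a0 az.
have /andP[s0 _] := s01.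
have p0 : 0 <= p by rewrite addr_ge0// mulr_ge0// ltW.
rewrite lef_pV2 ?posrE ?powR_gt0//.
by apply: ge0_ler_powR; rewrite ?nnegrE ?(ltW z0) ?(ltW a0).
Qed.

Lemma integrable_odd_kernel w a b : 0 < a ->
  mu.-integrable (annulus V a b) (EFin \o odd_kernel w).
Proof.
move=> a0; apply: (@integrable_annulus _ a b (enorm w * b * (a `^ p)^-1) a0).
  exact: measurable_odd_kernel.
move=> z Az; have /annulusP[_ az zb] := Az.
rewrite normrM [X in _ * X <= _]ger0_norm ?invr_ge0 ?powR_ge0//.
apply: ler_pM => //; first by rewrite invr_ge0 powR_ge0.
  apply: (@le_trans _ _ (enorm w * enorm z)).
    rewrite ler_norml edot_le andbT lerNl -edotNr.
    by apply: le_trans (edot_le _ _) _; rewrite enormN.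
  by rewrite ler_wpM2l ?enorm_ge0// ltW.
exact: kernel_annulus_le Az.
Qed.

Lemma integrable_near_kernel a b : 0 < a ->
  mu.-integrable (annulus V a b) (EFin \o (fun z => enorm z ^+ 2 / enorm z `^ p)).
Proof.
move=> a0; apply: (@integrable_annulus _ a b (b ^+ 2 * (a `^ p)^-1) a0).
  exact: measurable_near_kernel.
move=> z Az; have /annulusP[_ az zb] := Az.
rewrite normrM [X in _ * X <= _]ger0_norm ?invr_ge0 ?powR_ge0// ger0_norm ?exprn_ge0 ?enorm_ge0//.
apply: ler_pM; rewrite ?exprn_ge0 ?enorm_ge0 ?invr_ge0 ?powR_ge0//.
  by rewrite lerXn2r ?nnegrE ?enorm_ge0 ?(ltW zb)// (le_trans _ (ltW zb))// enorm_ge0.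
exact: kernel_annulus_le Az.
Qed.

(** The reflection [z |-> - z] preserves the annulus and the measure. Being
    finite and equal to its opposite, the integral is 0. *)
Lemma integral_odd_kernel w a b : 0 < a ->
  (\int[mu]_(z in annulus V a b) (odd_kernel w z)%:E = 0)%E.
Proof.
move=> a0; set A := annulus V a b.
pose neg : T -> T := fun z => - z.
have mneg : measurable_fun setT neg by exact: measurable_opp.
have AN : neg @^-1` A = A.
  apply/seteqP; split => z /= /annulusP[]; rewrite ?rpredN ?enormN => ? ? ?;
    by apply/annulusP; rewrite ?rpredN ?enormN.
have iA := integrable_odd_kernel w b a0.
have mA : measurable (A : set T) by exact: measurable_annulus.
pose f : T -> \bar R := fun z => (odd_kernel w z)%:E.
have oddN z : f (neg z) = (- f z)%E.
  by rewrite /f /neg /odd_kernel enormN edotNr mulNr.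
have mf : measurable_fun [set: T] f.
  by apply/measurable_EFinP; exact: measurable_odd_kernel.
have iN : mu.-integrable (neg @^-1` A) (f \o neg).
  by rewrite AN; apply: (eq_integrable mA _ _ _ (integrableN iA)) => z _ /=; rewrite oddN.
have := integral_pushforward mneg mf iN mA.
rewrite AN; set lhs := (X in X = _) => E.
have lhsE : lhs = (\int[mu]_(x in A) f x)%E.
  apply: (eq_measure_integral mu) => B mB BA.
  change (hausdorff n (neg @^-1` B) = hausdorff n B).
  have -> : neg @^-1` B = -%R @` B.
    apply/seteqP; split => [x Bx|_ [x Bx <-]] /=; last by rewrite /neg opprK.
    by exists (- x) => //; rewrite opprK.
  exact: hausdorffN.
have {E} : (\int[mu]_(x in A) f x = \int[mu]_(x in A) - f x)%E.
  by rewrite -lhsE E; apply: eq_integral => z _; rewrite /= oddN.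
rewrite integralN; last exact: (integrable_add_def mA iA).
have : (\int[mu]_(x in A) f x)%E \is a fin_num by exact: (integrable_fin_num mA iA).
rewrite -/f; case: (\int[mu]_(x in A) _)%E => // r _ /eqP.
by rewrite -EFinN eqe => /eqP rN; congr EFin; lra.
Qed.

(** The linear part of a quadratic function is odd, so it does not contribute. The
    quadratic part has a sign, so its integrals over the annuli increase as the
    inner radius shrinks, and they stay below the bound of [near_kernel_le]. *)
Lemma pv_ball_quadratic rho : 0 < rho -> exists I : R,
  [/\ 0 <= I, I <= near_constant n s * rho `^ (2 - 2 * s) * h &
   forall (phi : 'rV[R]_N -> R) x w beta,
     (forall z, phi (x + z) - phi x = edot w z + beta * enorm z ^+ 2) ->
     pv_ball s n V phi x rho = (beta * I)%:E].
Proof.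
move=> r0.
pose nk (z : 'rV[R]_N) := enorm z ^+ 2 / enorm z `^ p.
pose J eps := (\int[mu]_(z in annulus V eps rho) (nk z)%:E)%E.
have nk0 z : 0 <= nk z by rewrite divr_ge0 ?exprn_ge0 ?enorm_ge0 ?powR_ge0.
have J0 eps : (0 <= J eps)%E by apply: integral_ge0 => z _; rewrite lee_fin.
have mnk (D : set T) : measurable_fun D (EFin \o (nk : T -> R)).
  by apply/measurable_EFinP; exact: measurable_near_kernel.
pose G := near_constant n s * rho `^ (2 - 2 * s) * h.
have JG eps : 0 < eps -> (J eps <= G%:E)%E by move=> e0; exact: near_kernel_le.
have Jmono a b : a <= b -> (J b <= J a)%E.
  move=> ab; apply: ge0_subset_integral; [| | |move=> z _|].
  - exact: measurable_annulus.
  - exact: measurable_annulus.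
  - exact: mnk.
  - by rewrite lee_fin.
  - move=> z /annulusP[Vz bz zr]; apply/annulusP; split => //.
    exact: le_trans ab bz.
have inf0 : (BRight (0 : R) < BInfty R false)%O by [].
have JL := @nonincreasing_at_right_cvge R J 0 _ inf0 (fun a b _ _ ab => Jmono a b ab).
set L := ereal_sup _ in JL.
have LG : (L <= G%:E)%E.
  by apply: ge_ereal_sup => _ [a /= + <-]; rewrite in_itv /= andbT => /JG.
have L0 : (0 <= L)%E.
  apply: le_trans (J0 1) _; apply: ereal_sup_ubound; exists 1 => //=.
  by rewrite in_itv /= ltr01.
have Lfin : L \is a fin_num by rewrite ge0_fin_numE// (le_lt_trans LG) ?ltry.
exists (fine L); split.
- exact: fine_ge0.
- by rewrite -lee_fin fineK.
move=> phi x w beta phiE.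
rewrite EFinM fineK//; apply: cvg_lim => //.
apply: cvg_trans (cvgeZl _ JL); last by [].
apply: near_eq_cvg; near=> eps.
have e0 : 0 < eps by near: eps; exact: nbhs_right_gt.
have mA : measurable (annulus V eps rho : set T) by exact: measurable_annulus.
have iO := integrable_odd_kernel w rho e0.
have iN := integrable_near_kernel rho e0.
have iNb : mu.-integrable (annulus V eps rho)
   (EFin \o (fun z => beta * nk z)).
  by apply: (eq_integrable mA _ _ _ (integrableZl mA beta iN)) => z _ /=; rewrite EFinM.
transitivity (\int[mu]_(z in annulus V eps rho)
   ((EFin \o odd_kernel w) \+ (EFin \o (fun z => (beta * nk z)%R)))%E z)%E; last first.
  apply: eq_integral => z _ /=; rewrite -EFinD /quot phiE.
  by congr EFin; rewrite /odd_kernel /nk mulrDl mulrA.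
rewrite (integralD_EFin mA iO iNb) [X in (X + _)%E](integral_odd_kernel w rho e0) add0e.
rewrite /comp; under [RHS]eq_integral do rewrite EFinM.
by rewrite (integralZl mA iN).
Unshelve. all: by end_near.
Qed.

End principal_value.

Section quadratic_test_functions.
Context {R : realType} {N : nat}.
Implicit Types (x y z v : 'rV[R]_N) (f : 'rV[R]_N -> R).

Definition sq_distance (beta : R) y x : R := beta * edot (x - y) (x - y).

Lemma is_derive_affine_quotient f x v (a b : R) :
  (forall h, f (h *: v + x) - f x = a * h + b * h ^+ 2) -> is_derive x v f a.
Proof.
move=> fE.
have fa : h^-1 *: ((f \o shift x) (h *: v) - f x) @[h --> 0^'] --> a.
  apply: (@cvg_trans _ ((fun h => a + b * h) @ 0^')).
    apply: near_eq_cvg; near=> h.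
    have h0 : h != 0 by near: h; exact: nbhs_dnbhs_neq.
    by rewrite /= fE /GRing.scale /=; field.
  have : a + b * h @[h --> (0 : R)] --> a + b * 0.
    by apply: cvgD; [exact: cvg_cst|apply: cvgM; [exact: cvg_cst|exact: cvg_id]].
  by rewrite mulr0 addr0 => H; apply: cvg_within_filter.
by apply: DeriveDef; [apply/cvg_ex; exists a|exact: cvg_lim fa].
Unshelve. all: by end_near.
Qed.

Lemma C2_sq_distance (U : set 'rV[R]_N) (beta : R) y :
  C2_on U (sq_distance beta y).
Proof.
pose q := sq_distance beta y.
have ed v i : edot v (delta_mx 0 i) = v 0 i.
  rewrite /edot (bigD1 i)//= mxE !eqxx mulr1 big1 ?addr0// => j ji.
  by rewrite mxE (negbTE ji) andbF mulr0.
have dq x i : is_derive x (delta_mx 0 i) q (2 * beta * (x - y) 0 i).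
  apply: (@is_derive_affine_quotient _ _ _ _ beta) => h; rewrite /q /sq_distance.
  rewrite -addrA; move: (x - y) => w; rewrite edotDl !edotDr !edotZl !edotZr.
  rewrite (edotC _ w) !ed [X in h * (h * X)]mxE !eqxx /=; ring.
have dqE i : 'D_(delta_mx 0 i) q = fun x => 2 * beta * (x - y) 0 i.
  by apply/funext => x; rewrite (derive_val (is_derive := dq x i)).
have ddq x i j : is_derive x (delta_mx 0 j) (fun x => 2 * beta * (x - y) 0 i)
    (2 * beta * (delta_mx 0 j : 'rV[R]_N) 0 i).
  apply: (@is_derive_affine_quotient _ _ _ _ 0) => h; rewrite !mxE; ring.
split=> [x Ux i|i x Ux j].
  split; first by have [] := dq x i.
  have -> : 'D_(delta_mx 0 i) q = fun x => 2 * beta * (x 0 i - y 0 i).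
    by rewrite dqE; apply/funext => z; rewrite !mxE.
  apply: (@cvgM _ _ (nbhs x) _ (cst (2 * beta)) (fun x => x 0 i - y 0 i) (2 * beta) (x 0 i - y 0 i)); first exact: cvg_cst.
  by apply: cvgB; [exact: coord_continuous|exact: cvg_cst].
rewrite dqE; split; first by have [] := ddq x i j.
have -> : 'D_(delta_mx 0 j) (fun x => 2 * beta * (x - y) 0 i) =
    cst (2 * beta * (delta_mx 0 j : 'rV[R]_N) 0 i).
  by apply/funext => z; rewrite (derive_val (is_derive := ddq z i j)).
exact: cst_continuous.
Qed.

End quadratic_test_functions.

(** * Comparison of the operators on one subspace *)

Section operator_gap.
Context {R : realType} {N : nat}.
Variables (n : nat) (V : {vspace 'rV[R]_N}) (dimV : \dim V = n) (n0 : (0 < n)%N).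
Variables (s : R) (s01 : 0 < s < 1).
Let T := Defs.hausdorff_space R N n.
Let mu := hausdorff_measure R N n.
Let h := fine (hball n V).
Let p := n%:R + 2 * s.
Let kernel (z : 'rV[R]_N) := (enorm z `^ p)^-1.

Let h1 : 1 <= h.
Proof. by rewrite -lee_fin fineK ?hball_fin_num// hball_ge1. Qed.

Lemma measurable_outside r : measurable ([set` V] `\` eball 0 r : set T).
Proof.
by apply: measurableD; [exact: measurable_vspace|exact: measurable_eball0].
Qed.

Lemma integrable_tail_kernel r : 0 < r ->
  mu.-integrable ([set` V] `\` eball 0 r) (EFin \o (kernel : T -> R)).
Proof.
move=> r0; apply/integrableP; split.
  by apply/measurable_EFinP; exact: measurable_kernel.
have := tail_kernel_lty dimV n0 s01 r0; congr (_ < _)%E.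
apply: eq_integral => z _; rewrite /= ger0_norm//.
by rewrite invr_ge0 powR_ge0.
Qed.

Lemma integrable_quot (w : 'rV[R]_N -> R) x r M : 0 < r ->
  (forall y, `|w y| <= M) ->
  measurable_fun ([set` V] : set T) ((fun z => w (x + z)) : T -> R) ->
  mu.-integrable ([set` V] `\` eball 0 r) (EFin \o (quot s n w x : T -> R)).
Proof.
move=> r0 wM mw; have mE := measurable_outside r.
have iK := integrableZl mE (M + M) (integrable_tail_kernel r0).
apply: (le_integrable mE _ _ iK).
  apply/measurable_EFinP; apply: measurable_funM; last exact: measurable_kernel.
  apply: measurable_funB; last exact: measurable_cst.
  apply: measurable_funS mw; first exact: measurable_vspace.
  by move=> z [].
move=> z _; rewrite /= lee_fin !normrM.
have M0 : 0 <= M by exact: le_trans (normr_ge0 _) (wM x).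
rewrite ler_wpM2r// [leRHS]ger0_norm ?addr_ge0//.
by apply: le_trans (ler_normB _ _) _; rewrite lerD.
Qed.

(** The difference of the increments is nonpositive everywhere, so its integral can
    be restricted to [D <= |z|], where it is at most [- (u x - v y)]. *)
Lemma tail_gap (u v : 'rV[R]_N -> R) x y rho D Mu Mv :
  0 < rho -> rho <= D ->
  (forall z, `|u z| <= Mu) -> (forall z, `|v z| <= Mv) ->
  measurable_fun ([set` V] : set T) ((fun z => u (x + z)) : T -> R) ->
  measurable_fun ([set` V] : set T) ((fun z => v (y + z)) : T -> R) ->
  0 <= u x - v y ->
  (forall z, u (x + z) - v (y + z) <= u x - v y) ->
  (forall z, D <= enorm z -> u (x + z) - v (y + z) <= 0) ->
  exists Tu Tv : R, [/\ tail s n V u x rho = Tu%:E, tail s n V v y rho = Tv%:E &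
    Tu - Tv <= - ((u x - v y) * (h * (D `^ (- (2 * s)) / (2 * s))))].
Proof.
move=> r0 rD uM vM mu_ mv m0 uv uv0; have D0 := lt_le_trans r0 rD.
have mE r := measurable_outside r.
have iu := integrable_quot r0 uM mu_; have iv := integrable_quot r0 vM mv.
have Tufin := integrable_fin_num (mE rho) iu.
have Tvfin := integrable_fin_num (mE rho) iv.
exists (fine (tail s n V u x rho)), (fine (tail s n V v y rho)).
rewrite !fineK//; split => //.
rewrite lerNr opprB -lee_fin EFinB !fineK//.
rewrite [X in (_ <= X)%E](_ : _ = \int[mu]_(z in [set` V] `\` eball 0 rho)
   ((quot s n v y z)%:E - (quot s n u x z)%:E))%E; last first.
  by rewrite (integralB_EFin (mE rho) iv iu).
have iF := integrableB (mE rho) iv iu.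
have mF : measurable_fun ([set` V] `\` eball 0 rho : set T)
    (fun z : T => (quot s n v y z)%:E - (quot s n u x z)%:E)%E.
  exact: (measurable_int mu iF).
have FE z : ((quot s n v y z)%:E - (quot s n u x z)%:E =
    (((u x - v y) - (u (x + z) - v (y + z))) * kernel z)%:E)%E.
  by rewrite -EFinB /quot -mulrBl; congr (_ * _)%:E; ring.
have k0 z : 0 <= kernel z by rewrite invr_ge0 powR_ge0.
have sub : [set` V] `\` eball 0 D `<=` [set` V] `\` eball (0 : 'rV[R]_N) rho.
  by move=> z [Vz zD]; split => // zr; apply: zD; exact: lt_le_trans rD.
apply: (@le_trans _ _ (\int[mu]_(z in [set` V] `\` eball 0 D)
   ((quot s n v y z)%:E - (quot s n u x z)%:E))%E); last first.
  apply: ge0_subset_integral; [exact: mE|exact: mE|exact: mF| |exact: sub].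
  by move=> z _; rewrite FE lee_fin mulr_ge0// subr_ge0.
apply: (@le_trans _ _ (\int[mu]_(z in [set` V] `\` eball 0 D)
   ((u x - v y)%:E * (kernel z)%:E))%E); last first.
  apply: ge0_le_integral.
  - exact: mE.
  - by move=> z _; rewrite -EFinM lee_fin mulr_ge0.
  - apply: measurable_funeM; apply/measurable_EFinP; exact: measurable_kernel.
  - exact: (measurable_funS (mE rho) sub mF).
  - move=> z [_ zD]; rewrite FE -EFinM lee_fin ler_wpM2r// lerBrDr gerDl uv0//.
    by move: zD; rewrite /eball /= subr0 => /negP; rewrite -leNgt.
rewrite (integralZl (mE D) (integrable_tail_kernel D0)) EFinM.
by apply: lee_wpmul2l => //; exact: tail_kernel_ge.
Qed.

(** The two principal values differ by [2 * alpha * I], where [I] is at most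
    [hball n V] times a power of [rho], and the tails differ by at least
    [hball n V] times the main term. Since [hball n V >= 1], the common factor can
    be dropped from the resulting upper bound, which is nonpositive. *)
Lemma operator_gap (u v : 'rV[R]_N -> R) x y alpha rho D Mu Mv eta :
  0 < rho -> rho <= D -> 0 <= alpha ->
  (forall z, `|u z| <= Mu) -> (forall z, `|v z| <= Mv) ->
  measurable_fun ([set` V] : set T) ((fun z => u (x + z)) : T -> R) ->
  measurable_fun ([set` V] : set T) ((fun z => v (y + z)) : T -> R) ->
  0 <= u x - v y ->
  (forall z, u (x + z) - v (y + z) <= u x - v y) ->
  (forall z, D <= enorm z -> u (x + z) - v (y + z) <= 0) ->
  2 * alpha * (near_constant n s * rho `^ (2 - 2 * s)) <= eta ->
  eta <= (u x - v y) * (D `^ (- (2 * s)) / (2 * s)) ->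
  exists U W : R, [/\
    (pv_ball s n V (sq_distance alpha y) x rho +
      tail s n V u x rho = U%:E)%E,
    (pv_ball s n V (sq_distance (- alpha) x) y rho +
      tail s n V v y rho = W%:E)%E &
    U - W <= eta - (u x - v y) * (D `^ (- (2 * s)) / (2 * s))].
Proof.
move=> r0 rD a0 uM vM mu_ mv m0 uv uv0 aeta etam.
have [Tu [Tv [-> -> TT]]] := tail_gap r0 rD uM vM mu_ mv m0 uv uv0.
have [I [I0 IG pvE]] := pv_ball_quadratic dimV n0 s01 r0.
rewrite (pvE _ x (2 * alpha *: (x - y)) alpha); last first.
  move=> z; rewrite /sq_distance [_ + z - _]addrAC; move: (x - y) => w.
  by rewrite edotDl !edotDr edotZl enorm_sq (edotC z w); ring.
rewrite (pvE _ y (- (2 * alpha) *: (y - x)) (- alpha)); last first.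
  move=> z; rewrite /sq_distance [_ + z - _]addrAC; move: (y - x) => w.
  by rewrite edotDl !edotDr edotZl enorm_sq (edotC z w); ring.
exists (alpha * I + Tu), (- alpha * I + Tv); rewrite -!EFinD; split => //.
set b := D `^ (- (2 * s)) / (2 * s) in etam TT *; set m := u x - v y in etam TT *.
have : 2 * alpha * I <= eta * h.
  apply: (@le_trans _ _ (2 * alpha * (near_constant n s * rho `^ (2 - 2 * s) * h))).
    by rewrite ler_wpM2l// mulr_ge0.
  by rewrite mulrA ler_wpM2r// (le_trans ler01 h1).
have : (m * b - eta) * 1 <= (m * b - eta) * h by rewrite ler_wpM2l// subr_ge0.
rewrite mulr1 => *; nra.
Qed.

End operator_gap.

(** * Semicontinuous functions on compact sets, and the doubling of variables *)

(** A cluster point of the image filter stands for the limit of a convergent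
    subsequence. *)
Lemma compact_frequently {T : topologicalType} (K : set T) (a : nat -> T) :
  compact K -> (forall n, K (a n)) ->
  exists2 p, K p & forall B, nbhs p B -> forall m, exists2 n, (m <= n)%N & B (a n).
Proof.
move=> cK Ka; have := cK (a @ \oo) _; case.
  by exists 0%N => // n _; exact: Ka.
move=> p [Kp clp]; exists p => // B pB m.
have Fm : (a @ \oo) (a @` [set n | (m <= n)%N]).
  by exists m => // n mn; exists n.
by have [_ [[n mn <-] Bn]] := clp _ _ Fm pB; exists n.
Qed.

(** At a cluster point of a maximizing sequence, semicontinuity prevents the value
    from being below the supremum. *)
Lemma usc_attains_max {R : realType} {T : topologicalType} (K : set T) (f : T -> R) (M : R) :
  compact K -> K !=set0 -> (forall t, K t -> f t <= M) ->
  (forall t, K t -> forall e, 0 < e -> nbhs t [set q | K q -> f q < f t + e]) ->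
  exists2 t, K t & forall q, K q -> f q <= f t.
Proof.
move=> cK [t0 Kt0] fM usc.
pose S := sup (f @` K).
have hS : has_sup (f @` K).
  by split; [exists (f t0); exists t0|exists M => _ [t Kt <-]; exact: fM].
have ex (n : nat) : exists t, K t /\ S - n.+1%:R^-1 < f t.
  have [|_ [t Kt <-] St] := sup_adherent (eps := n.+1%:R^-1) _ hS; first by rewrite invr_gt0.
  by exists t.
have [a aP] := choice ex.
have [p Kp freq] := compact_frequently cK (fun n => (aP n).1).
exists p => // q Kq; apply: (@le_trans _ _ S).
  by apply: sup_upper_bound hS _ _; exists q.
rewrite leNgt; apply/negP => fpS.
pose e := (S - f p) / 2.
have e0 : 0 < e by rewrite divr_gt0// subr_gt0.
have [m me] := ltr_add_invr e0.
have [n mn] := freq _ (usc p Kp e e0) m.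
have [Kan San] := aP n => /(_ Kan).
have : n.+1%:R^-1 <= m.+1%:R^-1 :> R by rewrite lef_pV2 ?posrE// ler_nat.
by move: me San; rewrite /e; move: S fpS {hS ex aP e e0} (n.+1%:R^-1) (m.+1%:R^-1) => S fpS i j; lra.
Qed.

Section doubling.
Context {R : realType} {N : nat}.
Implicit Types (K Omega : set 'rV[R]_N) (f : 'rV[R]_N -> R) (a b p q x y z : 'rV[R]_N).

Lemma usc_onP K f p e : usc_on K f -> K p -> 0 < e ->
  exists2 r, 0 < r & forall q, K q -> enorm (q - p) < r -> f q < f p + e.
Proof.
move=> uscf Kp e0.
have [|V] := uscf p (- f p - e).
  by rewrite /= lte_fin; lra.
rewrite /nbhs /= -(nbhs_subspace_in Kp) => /nbhs_eballP[r r0 rW] VK.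
exists r => // q Kq qp; have : V q by apply: rW.
by move/VK; rewrite /= lte_fin; lra.
Qed.

Lemma lsc_onN K f : lsc_on K f -> usc_on K (fun x => - f x).
Proof.
by rewrite /usc_on; have -> : (fun x => - - f x) = f by apply/funext => x; rewrite opprK.
Qed.

Lemma compact_close_sequences K (a b : nat -> 'rV[R]_N) : compact K ->
  (forall n, K (a n)) -> (forall n, enorm (a n - b n) < n.+1%:R^-1) ->
  exists2 p, K p & forall e, 0 < e -> exists n, enorm (a n - p) < e /\ enorm (b n - p) < e.
Proof.
move=> cK Ka ab; have [p Kp freq] := compact_frequently cK Ka.
exists p => // e e0; have e20 : 0 < e / 2 by rewrite divr_gt0.
have [m me] := ltr_add_invr e20.
have [n mn an] := freq _ (near_eball p e20) m.
exists n; rewrite /eball /= in an.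
have : n.+1%:R^-1 <= m.+1%:R^-1 :> R by rewrite lef_pV2 ?posrE// ler_nat.
have := enorm_triangleB (b n) (a n) p; rewrite (enormB (b n) (a n)); have := ab n.
by move: me; move: (n.+1%:R^-1) (m.+1%:R^-1) => i j *; split; lra.
Qed.

Variables (Omega : set 'rV[R]_N) (u v c f : 'rV[R]_N -> R).
Hypotheses (oO : open Omega) (bO : bounded_set Omega).
Hypotheses (cc : {within Omega, continuous c}) (cf : {within Omega, continuous f}).
Hypotheses (usc : usc_on (closure Omega) u) (lsc : lsc_on (closure Omega) v).
Hypotheses (u0 : forall x, ~ Omega x -> u x <= 0) (v0 : forall x, ~ Omega x -> 0 <= v x).
Variable M : R.
Hypothesis M0 : 0 < M.
Let K := closure Omega.

Lemma compact_closure_bounded : compact K.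
Proof.
apply: bounded_closed_compact; last exact: closed_closure.
case: bO => B [Br BP]; exists (B + 1); split; first by rewrite realD.
move=> B' BB' x Kx; have B1 : B < (B + B') / 2 by lra.
have [y [Oy xy]] : (Omega `&` ball x (B' - (B + B') / 2)) !=set0.
  by apply: Kx; apply: nbhsx_ballx; lra.
have := BP _ B1 y Oy; move: xy; rewrite -ball_normE /= => xy yB.
have : `|x| <= `|x - y| + `|y| by rewrite (le_trans _ (ler_normD _ _))// subrK.
by lra.
Qed.

Let vusc : usc_on K (fun x => - v x) := lsc_onN lsc.

Let OK x : Omega x -> K x. Proof. exact: subset_closure. Qed.

Let notclose (P : 'rV[R]_N -> 'rV[R]_N -> Prop) :
  ~ (exists2 tau, 0 < tau & forall a b, enorm (a - b) < tau -> P a b) ->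
  exists a b : nat -> 'rV[R]_N, forall n, enorm (a n - b n) < n.+1%:R^-1 /\ ~ P (a n) (b n).
Proof.
move=> nP.
have ex n : exists ab : 'rV[R]_N * 'rV[R]_N, enorm (ab.1 - ab.2) < n.+1%:R^-1 /\ ~ P ab.1 ab.2.
  apply: contrapT => /forallNP h; apply: nP; exists (n.+1%:R^-1); first by rewrite invr_gt0.
  by move=> a b abn; apply: contrapT => nPab; apply: (h (a, b)).
by have [ab abP] := choice ex; exists (fun n => (ab n).1), (fun n => (ab n).2).
Qed.

(** Otherwise points where [w] exceeds [M] and points off [Omega] accumulate at a
    common [p]. Semicontinuity gives [0 < w p], so [p] is in the open set [Omega],
    which then contains some of the points chosen off it. *)
Lemma usc_small_near_complement w : usc_on K w -> (forall x, ~ Omega x -> w x <= 0) ->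
  exists2 tau, 0 < tau &
    forall a b, enorm (a - b) < tau -> Omega a -> ~ Omega b -> w a <= M.
Proof.
move=> uw w0; apply: contrapT => /notclose[a [b ab]].
have abP n : [/\ Omega (a n), ~ Omega (b n) & M < w (a n)].
  have [_] := ab n => /not_implyP[Oa] /not_implyP[Ob] /negP.
  by rewrite -ltNge.
have Ka n : K (a n) by apply: OK; have [] := abP n.
have [p Kp pP] := compact_close_sequences compact_closure_bounded Ka (fun n => (ab n).1).
have Op : Omega p.
  apply: contrapT => /w0 wp; have [r r0 rP] := usc_onP uw Kp M0.
  have [n [/(rP _ (Ka n)) an _]] := pP _ r0.
  by have [_ _] := abP n; lra.
have /nbhs_eballP[r r0 rO] : nbhs p Omega by exact: open_nbhs_nbhs.
by have [n [_ /rO bn]] := pP _ r0; have [] := abP n.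
Qed.

(** Otherwise pairs of merging points accumulate at some [p] of the closure where,
    by semicontinuity, [M <= u p - v p]. The boundary values exclude that [p] be
    off [Omega], and [c] and [f] are continuous at [p]. *)
Lemma near_diagonal eta : 0 < eta -> exists2 tau, 0 < tau &
  forall a b, enorm (a - b) < tau -> K a -> K b -> M <= u a - v b ->
    [/\ Omega a, Omega b, `|c a - c b| < eta & `|f a - f b| < eta].
Proof.
move=> eta0; apply: contrapT => /notclose[a [b ab]].
have abP n : [/\ K (a n), K (b n), M <= u (a n) - v (b n) &
    ~ [/\ Omega (a n), Omega (b n), `|c (a n) - c (b n)| < eta
      & `|f (a n) - f (b n)| < eta]].
  by have [_] := ab n => /not_implyP[Oa] /not_implyP[Ob] /not_implyP[? ?].
have Ka n : K (a n) by have [] := abP n.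
have [p Kp pP] := compact_close_sequences compact_closure_bounded Ka (fun n => (ab n).1).
have M20 : 0 < M / 2 by rewrite divr_gt0.
have Op : Omega p.
  apply: contrapT => nOp; have up := u0 nOp; have vp := v0 nOp.
  have [r r0 rP] := usc_onP usc Kp M20; have [r' r'0 rP'] := usc_onP vusc Kp M20.
  have rr0 : 0 < Num.min r r' by rewrite lt_min r0.
  have [n [an bn]] := pP _ rr0; have [Kan Kbn Mn _] := abP n.
  have := rP _ Kan; have := rP' _ Kbn; move: an bn; rewrite !lt_min.
  by move=> /andP[a1 _] /andP[_ b2] /(_ b2) + /(_ a1); lra.
have /nbhs_eballP[r r0 rO] : nbhs p Omega by exact: open_nbhs_nbhs.
have cont (g : 'rV[R]_N -> R) : {within Omega, continuous g} -> exists2 r', 0 < r' &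
    forall q, enorm (q - p) < r' -> `|g p - g q| < eta / 2.
  rewrite continuous_open_subspace// => /(_ p); rewrite inE => /(_ Op).
  have eta20 : 0 < eta / 2 by rewrite divr_gt0.
  move=> /cvgrPdist_lt/(_ _ eta20)/nbhs_eballP[r' r'0 rP'].
  by exists r' => // q; exact: rP'.
have [r1 r10 rc] := cont _ cc; have [r2 r20 rf] := cont _ cf.
have rr0 : 0 < Num.min r (Num.min r1 r2) by rewrite !lt_min r0 r10.
have [n [an bn]] := pP _ rr0; have [_ _ _] := abP n; apply.
move: an bn; rewrite !lt_min => /and3P[a0 a1 a2] /and3P[b0 b1 b2].
split; [exact: rO|exact: rO| |].
- have := ler_distD (c p) (c (a n)) (c (b n)).
  by have := rc _ a1; have := rc _ b1; rewrite (distrC (c p) (c (a n))); lra.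
- have := ler_distD (f p) (f (a n)) (f (b n)).
  by have := rf _ a2; have := rf _ b2; rewrite (distrC (f p) (f (a n))); lra.
Qed.

End doubling.

Section maximum_principle_tools.
Context {R : realType} {N : nat}.
Implicit Types (K Omega : set 'rV[R]_N) (u v : 'rV[R]_N -> R) (a b x y z : 'rV[R]_N).

Lemma enorm_sq_lower a b p q d : enorm (a - p) < d -> enorm (b - q) < d ->
  enorm (p - q) ^+ 2 - 4 * d * enorm (p - q) <= enorm (a - b) ^+ 2 :> R.
Proof.
move=> ap bq.
have h1 := enorm_triangleB p a q; have h2 := enorm_triangleB a b q.
have d0 : 0 < d by exact: le_lt_trans (enorm_ge0 _) ap.
move: h1 h2 ap bq (enorm_ge0 (a - b)) (enorm_ge0 (p - q)); rewrite (enormB p a).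
move: (enorm (a - p)) (enorm (b - q)) (enorm (a - b)) (enorm (p - q)) => A B C E.
move=> h1 h2 Ad Bd C0 E0; have [E2|E2] := leP E (2 * d); first by nra.
by have EC : E - 2 * d <= C by [lra]; nra.
Qed.

Lemma doubling_max K u v alpha Mu Mv : compact K -> K !=set0 -> 0 <= alpha ->
  usc_on K u -> lsc_on K v -> (forall x, `|u x| <= Mu) -> (forall x, `|v x| <= Mv) ->
  exists x y, [/\ K x, K y & forall a b, K a -> K b ->
    u a - v b - alpha * enorm (a - b) ^+ 2 <= u x - v y - alpha * enorm (x - y) ^+ 2].
Proof.
move=> cK [t0 Kt0] a0 usc lsc uM vM.
have vusc := lsc_onN lsc.
pose F (t : 'rV[R]_N * 'rV[R]_N) := u t.1 - v t.2 - alpha * enorm (t.1 - t.2) ^+ 2.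
have [||||[x y] [Kx Ky] xymax] := @usc_attains_max _ ('rV[R]_N * 'rV[R]_N)%type (K `*` K) F (Mu + Mv).
- exact: compact_setX.
- by exists (t0, t0).
- move=> [a b] _; rewrite /F /=.
  have : 0 <= alpha * enorm (a - b) ^+ 2 by rewrite mulr_ge0// exprn_ge0// enorm_ge0.
  by have := uM a; have := vM b; rewrite !ler_norml => /andP[? ?] /andP[? ?]; lra.
- move=> [p q] [/= Kp Kq] e e0; have e30 : 0 < e / 3 by rewrite divr_gt0.
  have [r1 r10 r1P] := usc_onP usc Kp e30; have [r2 r20 r2P] := usc_onP vusc Kq e30.
  have E0 := enorm_ge0 (p - q).
  (* a displacement by [d] lowers the penalty by at most [e / 3] *)
  pose d := e / 3 / (4 * alpha * enorm (p - q) + 1).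
  have den0 : 0 < 4 * alpha * enorm (p - q) + 1 by rewrite ltr_wpDl// !mulr_ge0.
  have d0 : 0 < d by rewrite divr_gt0.
  have dE : d * (4 * alpha * enorm (p - q) + 1) = e / 3 by rewrite divfK ?gt_eqF.
  exists (eball p (Num.min r1 d), eball q (Num.min r2 d)).
    by split; apply: near_eball; rewrite lt_min ?r10 ?r20.
  move=> [a b] [] /=; rewrite /eball /= !lt_min => /andP[a1 a2] /andP[b1 b2] [/= Ka Kb].
  have := r1P _ Ka a1; have := r2P _ Kb b1; rewrite /F /=.
  have := ler_wpM2l a0 (enorm_sq_lower a2 b2).
  by rewrite mulrBr; nra.
by exists x, y; split => // a b Ka Kb; apply: (xymax (a, b)).
Qed.

Lemma ediam_fin_num Omega : bounded_set Omega -> Omega !=set0 ->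
  ediam Omega \is a fin_num.
Proof.
move=> [B [Br BP]] O0; rewrite ge0_fin_numE ?ediam_ge0//.
apply: (@le_lt_trans _ _ (N%:R * ((B + 1) + (B + 1)))%:E); last by rewrite ltry.
have B1 : B < B + 1 by lra.
apply: ediam_le => x y Ox Oy; apply: le_trans (enorm_le_norm _) _.
rewrite ler_wpM2l//; apply: le_trans (ler_normB _ _) _.
by apply: lerD; exact: BP B1 _ _.
Qed.

Lemma diam_gt0 Omega x : (0 < N)%N -> open Omega -> Omega x ->
  ediam Omega \is a fin_num -> 0 < fine (ediam Omega).
Proof.
move=> N0 oO Ox fO.
have /nbhs_eballP[r r0 rO] : nbhs x Omega by exact: open_nbhs_nbhs.
pose w : 'rV[R]_N := (r / 2) *: delta_mx 0 (Ordinal N0).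
have w0 : 0 < enorm w.
  rewrite lt_neqAle enorm_ge0 andbT eq_sym; apply/negP => /eqP/enorm0_eq0/rowP.
  by move=> /(_ (Ordinal N0)); rewrite !mxE !eqxx mulr1; move: r0; lra.
have wr : enorm w < r.
  have wE : enorm w = r / 2.
    rewrite enormZ ger0_norm ?divr_ge0 ?(ltW r0)//.
    have -> : enorm (delta_mx 0 (Ordinal N0) : 'rV[R]_N) = 1; last by rewrite mulr1.
    rewrite /enorm /edot (bigD1 (Ordinal N0))//= !mxE !eqxx mulr1 big1 ?addr0 ?sqrtr1//.
    by move=> j jN; rewrite !mxE (negbTE jN) andbF mulr0.
  by rewrite wE; lra.
apply: lt_le_trans w0 _.
have -> : w = (x + w) - x by rewrite addrAC subrr add0r.
apply: (enorm_le_ediam (esym (fineK fO))) => //; apply: rO.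
by rewrite /eball /= addrAC subrr add0r.
Qed.

(** Otherwise [a + z] could be moved a little further along [z] within [Omega], and
    its distance to [a] would exceed the diameter. *)
Lemma open_ediam_out Omega a z : open Omega -> ediam Omega \is a fin_num ->
  0 < fine (ediam Omega) -> Omega a -> fine (ediam Omega) <= enorm z -> ~ Omega (a + z).
Proof.
move=> oO fO D0 Oa Dz Oz; have z0 := lt_le_trans D0 Dz.
have /nbhs_eballP[r r0 rO] : nbhs (a + z) Omega by exact: open_nbhs_nbhs.
pose t := r / (2 * enorm z).
have t0 : 0 < t by rewrite divr_gt0// mulr_gt0.
have Ot : Omega (a + z + t *: z).
  apply: rO; rewrite /eball /= addrAC subrr add0r enormZ gtr0_norm//.
  have -> : t * enorm z = r / 2 by rewrite /t; field; rewrite gt_eqF.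
  lra.
have := enorm_le_ediam (esym (fineK fO)) Ot Oa.
have -> : a + z + t *: z - a = (1 + t) *: z.
  by rewrite -[a + z + _]addrA [a + _]addrC addrK scalerDl scale1r.
rewrite enormZ gtr0_norm ?addr_gt0// mulrDl mul1r.
by have : 0 < t * enorm z by [rewrite mulr_gt0]; lra.
Qed.

Lemma exists_small_radius (l : nat) (g : 'I_l -> R) (r e t : R) : 0 < r -> 0 < e -> 0 < t ->
  exists rho, [/\ 0 < rho, rho <= r & forall i, g i * rho `^ t <= e].
Proof.
move=> r0 e0 t0; pose G := \sum_i `|g i| + 1.
have G0 : 0 < G by rewrite ltr_wpDl// sumr_ge0.
have eG : 0 < e / G by rewrite divr_gt0.
exists (Num.min r ((e / G) `^ t^-1)); split.
- by rewrite lt_min r0 powR_gt0.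
- by rewrite ge_min lexx.
move=> i; set rho := Num.min _ _.
have rho0 : 0 <= rho by rewrite le_min (ltW r0) powR_ge0.
have : rho `^ t <= e / G.
  apply: (@le_trans _ _ (((e / G) `^ t^-1) `^ t)).
    apply: ge0_ler_powR; rewrite ?nnegrE ?(ltW t0) ?powR_ge0//.
    by rewrite ge_min lexx orbT.
  by rewrite -powRrM mulVf ?gt_eqF// powRr1// ltW.
rewrite ler_pdivlMr// mulrC => h; apply: le_trans h.
apply: ler_wpM2r; first exact: powR_ge0.
rewrite /G (bigD1 i)//= -addrA; apply: le_trans (ler_norm _) _.
by rewrite lerDl addr_ge0// sumr_ge0.
Qed.

(** The frame is chosen near optimal for the subsolution in the case of the
    supremum, and for the supersolution in the case of the infimum. *)
Lemma common_frame {I : Type} (F : set I) (e : extremal) (su sv : I -> \bar R) (gu gv d : R) :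
  0 < d ->
  (0 <= extr e [set su i | i in F] + gu%:E)%E ->
  (extr e [set sv i | i in F] + gv%:E <= 0)%E ->
  exists i, [/\ F i, ((- gu - d)%:E <= su i)%E & (sv i <= (- gv + d)%:E)%E].
Proof.
move=> d0; rewrite -leeBlDr// sub0e -leeBrDr// sub0e => hu hv.
have gu_d : ((- gu - d)%:E < - gu%:E)%E by rewrite -EFinN lte_fin; lra.
have gv_d : (- gv%:E < (- gv + d)%:E)%E by rewrite -EFinN lte_fin; lra.
case: e hu hv => /= hu hv.
  have [_ [i Fi <-] lt] := ereal_sup_gt (lt_le_trans gu_d hu).
  exists i; split => //; first exact: ltW.
  by rewrite (le_trans _ (ltW gv_d))// (le_trans _ hv)// ereal_sup_ubound//; exists i.
have [_ [i Fi <-] lt] := ereal_inf_lt (le_lt_trans hv gv_d).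
exists i; split => //; last exact: ltW.
by rewrite (le_trans (ltW gu_d))// (le_trans hu)// ereal_inf_lbound//; exists i.
Qed.

End maximum_principle_tools.

Unset Implicit Arguments.

(** * The comparison principle *)

Theorem theorem4p1 (R : realType) (N l : nat) (s : R) (k : 'I_l -> nat)
    (C : nat -> R -> R) (e : extremal) (Omega : set 'rV[R]_N)
    (c f u v : 'rV[R]_N -> R) :
  0 < s < 1 ->
  (1 <= l <= N)%N ->
  (forall i, 1 <= k i <= N)%N ->
  (forall i j : 'I_l, i <= j -> k i <= k j)%N ->
  (\sum_(i < l) k i <= N)%N ->
  (forall (n : nat) (t : R), (0 < n)%N -> 0 < t < 1 -> 0 < C n t) ->
  is_domain Omega -> bounded_set Omega ->
  {within Omega, continuous c} -> {within Omega, continuous f} ->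
  (ereal_sup [set (Num.max (c x) 0)%:E | x in Omega] <
   (\sum_(i < l) C (k i) s * (1 / (2 * s)) *
      fine (ediam Omega) `^ (- (2 * s)))%:E)%E ->
  usc_on (closure Omega) u -> Linfty u ->
  lsc_on (closure Omega) v -> Linfty v ->
  dirichlet_subsolution C s k e Omega (fun x t => c x * t - f x) u ->
  dirichlet_supersolution C s k e Omega (fun x t => c x * t - f x) v ->
  forall x, Omega x -> u x <= v x.
Proof.
move=> s01 lN kN _ _ C0 [oO _ O0] bO cc cf csmall usc [_ [Mu uM]] lsc [_ [Mv vM]].
move=> [[_ pmu _ sub] u0] [[_ pmv _ sup] v0] x0 Ox0.
rewrite leNgt; apply/negP => vu.
have M0 : 0 < u x0 - v x0 by rewrite subr_gt0.
set M := u x0 - v x0 in M0; pose K := closure Omega.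
have OK : Omega `<=` K by exact: subset_closure.
have fO := ediam_fin_num bO O0.
have N0 : (0 < N)%N by case/andP: lN => l0 /(leq_trans l0).
have D0 := diam_gt0 N0 oO Ox0 fO; set D := fine (ediam Omega) in D0.
have [s0 s1] : 0 < s /\ s < 1 by case/andP: s01.
pose b := D `^ (- (2 * s)) / (2 * s).
have b0 : 0 < b by rewrite divr_gt0 ?powR_gt0// mulr_gt0.
have k0 i : (0 < k i)%N by have /andP[] := kN i.
have Ci i : 0 < C (k i) s by exact: C0.
pose Csum := \sum_(i < l) C (k i) s.
have Csum0 : 0 <= Csum by apply: sumr_ge0 => i _; exact: ltW.
have [S [cS SC]] : exists S, (forall x, Omega x -> c x <= S) /\ S < Csum * b.
  move: csmall; set E := [set _ | x in Omega] => csmall.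
  have Eub x : Omega x -> ((Num.max (c x) 0)%:E <= ereal_sup E)%E.
    by move=> Ox; apply: ereal_sup_ubound; exists x.
  have Efin : ereal_sup E \is a fin_num.
    rewrite ge0_fin_numE; first by rewrite (lt_le_trans csmall)// leey.
    by rewrite (le_trans _ (Eub _ Ox0))// lee_fin le_max lexx orbT.
  exists (fine (ereal_sup E)); split => [x /Eub|].
    by rewrite -{1}(fineK Efin) lee_fin ge_max => /andP[].
  rewrite -lte_fin fineK//; apply: lt_le_trans csmall _.
  rewrite lee_fin mulr_suml; apply: ler_sum => i _.
  by rewrite /b -mulrA le_eqVlt; apply/orP; left; apply/eqP; field; rewrite gt_eqF.
(* the errors of the final inequality are fractions of [gap] *)
pose gap := M * (Csum * b - S).
have gap0 : 0 < gap by rewrite mulr_gt0// subr_gt0.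
have Mv0 : 0 <= Mv by exact: le_trans (normr_ge0 _) (vM x0).
have Mu0 : 0 <= Mu by exact: le_trans (normr_ge0 _) (uM x0).
pose eta := gap / (4 * (Mv + 1)).
have eta0 : 0 < eta by rewrite divr_gt0// mulr_gt0// ltr_wpDl.
pose delta := gap / 8.
have delta0 : 0 < delta by rewrite divr_gt0.
pose eps := Num.min (gap / (4 * (Csum + 1))) (M * b).
have eps0 : 0 < eps by rewrite lt_min (mulr_gt0 M0 b0) divr_gt0// mulr_gt0// ltr_wpDl.
have vusc : usc_on K (fun x => - v x) by exact: lsc_onN.
have nv0 x : ~ Omega x -> - v x <= 0 by move=> /v0; rewrite oppr_le0.
have [t1 t10 diag] := near_diagonal oO bO cc cf usc lsc u0 v0 M0 eta0.
have [t2 t20 ucl] := usc_small_near_complement oO bO M0 usc u0.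
have [t3 t30 vcl] := usc_small_near_complement oO bO M0 vusc nv0.
pose tau := Num.min t1 (Num.min t2 t3).
have tau0 : 0 < tau by rewrite !lt_min t10 t20.
(* for [tau <= |x - y|] the penalty would exceed all the values of [u - v] *)
pose alpha := (Mu + Mv + 1) / tau ^+ 2.
have a0 : 0 < alpha by rewrite divr_gt0 ?exprn_gt0// ltr_wpDl// addr_ge0.
have cK : compact K by exact: compact_closure_bounded.
have K0 : K !=set0 by exists x0; exact: OK.
have [x [y [Kx Ky xymax]]] := doubling_max cK K0 (ltW a0) usc lsc uM vM.
have q0 : 0 <= alpha * enorm (x - y) ^+ 2.
  by rewrite mulr_ge0 ?(ltW a0)// exprn_ge0// enorm_ge0.
(* comparison of the maximum with the value at [(x0, x0)] *)
have mx : M + alpha * enorm (x - y) ^+ 2 <= u x - v y.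
  have := xymax x0 x0 (OK _ Ox0) (OK _ Ox0); rewrite subrr enorm0 expr0n mulr0 subr0.
  by rewrite -/M; lra.
have xyt : enorm (x - y) < tau.
  rewrite ltNge; apply/negP => txy.
  have : alpha * tau ^+ 2 <= alpha * enorm (x - y) ^+ 2.
    by rewrite ler_pM2l// lerXn2r ?nnegrE ?enorm_ge0// ltW.
  rewrite {1}/alpha divfK ?gt_eqF ?exprn_gt0// => h.
  by have := uM x; have := vM y; rewrite !ler_norml => /andP[? ?] /andP[? ?]; lra.
have mM : M <= u x - v y by lra.
have := xyt; rewrite !lt_min => /and3P[xy1 xy2 xy3].
have [Ox Oy cxy fxy] := diag _ _ xy1 Kx Ky mM.
have shift z : x + z - (y + z) = x - y by rewrite opprD addrACA subrr addr0.
(* of the points [x + z] and [y + z], none, one or both may be in [Omega] *)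
have uvz z : u (x + z) - v (y + z) <= u x - v y.
  have [Oxz|nOxz] := pselect (Omega (x + z)); have [Oyz|nOyz] := pselect (Omega (y + z)).
  - by have := xymax _ _ (OK _ Oxz) (OK _ Oyz); rewrite shift; lra.
  - have := ucl (x + z) (y + z); rewrite shift => /(_ xy2 Oxz nOyz).
    by have := v0 _ nOyz; lra.
  - have := vcl (y + z) (x + z); rewrite enormB shift => /(_ xy3 Oyz nOxz).
    by have := u0 _ nOxz; lra.
  - by have := u0 _ nOxz; have := v0 _ nOyz; lra.
have uvD z : D <= enorm z -> u (x + z) - v (y + z) <= 0.
  move=> Dz; have := u0 _ (open_ediam_out oO fO D0 Ox Dz).
  by have := v0 _ (open_ediam_out oO fO D0 Oy Dz); lra.
have /nbhs_eballP[r1 r10 r1O] : nbhs x Omega by exact: open_nbhs_nbhs.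
have /nbhs_eballP[r2 r20 r2O] : nbhs y Omega by exact: open_nbhs_nbhs.
have r0 : 0 < Num.min (Num.min r1 r2) D by rewrite !lt_min r10 r20.
have s2 : 0 < 2 - 2 * s by lra.
have [rho [rho0 rhor rhoe]] := exists_small_radius
  (fun i => 2 * alpha * near_constant (k i) s) r0 eps0 s2.
move: rhor; rewrite !le_min => /andP[/andP[rho1 rho2] rhoD].
have touchu y' : eball x rho y' ->
    u y' - sq_distance alpha y y' <= u x - sq_distance alpha y x.
  move=> xy'; have /r1O/OK Ky' : eball x r1 y' by exact: lt_le_trans rho1.
  by have := xymax _ _ Ky' Ky; rewrite /sq_distance -!enorm_sq; lra.
have touchv y' : eball y rho y' ->
    v y - sq_distance (- alpha) x y <= v y' - sq_distance (- alpha) x y'.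
  move=> xy'; have /r2O/OK Ky' : eball y r2 y' by exact: lt_le_trans rho2.
  have := xymax _ _ Kx Ky'; rewrite /sq_distance -!enorm_sq !(enormB _ x).
  by rewrite !mulNr; lra.
have hu := sub x rho _ Ox rho0 (C2_sq_distance _ _ _) touchu.
have hv := sup y rho _ Oy rho0 (C2_sq_distance _ _ _) touchv.
have [Vs [[dimVs _] suV svV]] := common_frame delta0 hu hv.
have UWex i : exists UW : R * R, [/\
    (pv_ball s (k i) (Vs i) (sq_distance alpha y) x rho + tail s (k i) (Vs i) u x rho = UW.1%:E)%E,
    (pv_ball s (k i) (Vs i) (sq_distance (- alpha) x) y rho + tail s (k i) (Vs i) v y rho = UW.2%:E)%E &
    UW.1 - UW.2 <= eps - (u x - v y) * b].
  have m0 : 0 <= u x - v y by exact: le_trans (ltW M0) mM.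
  have rhoei : 2 * alpha * (near_constant (k i) s * rho `^ (2 - 2 * s)) <= eps.
    by rewrite mulrA rhoe.
  have epsm : eps <= (u x - v y) * b.
    by rewrite ge_min [X in _ || X]ler_pM2r// mM orbT.
  have [U [W UW]] := operator_gap (dimVs i) (k0 i) s01 rho0 rhoD (ltW a0) uM vM
    (pmu _ Ox i _ (dimVs i)) (pmv _ Oy i _ (dimVs i)) m0 uvz uvD rhoei epsm.
  by exists (U, W).
have [UW UWP] := choice UWex.
have suE : - (c x * u x - f x) - delta <= \sum_(i < l) C (k i) s * (UW i).1.
  rewrite -lee_fin; apply: le_trans suV _; rewrite -sumEFin.
  by apply: lee_sum => i _; have [E _ _] := UWP i; rewrite EFinM -E.
have svE : \sum_(i < l) C (k i) s * (UW i).2 <= - (c y * v y - f y) + delta.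
  rewrite -lee_fin; apply: le_trans svV; rewrite -sumEFin.
  by apply: lee_sum => i _; have [_ E _] := UWP i; rewrite EFinM -E.
have diff : \sum_(i < l) C (k i) s * (UW i).1 - \sum_(i < l) C (k i) s * (UW i).2
    <= Csum * (eps - (u x - v y) * b).
  rewrite -sumrB mulr_suml; apply: ler_sum => i _; rewrite -mulrBr ler_pM2l//.
  by have [] := UWP i.
have e1 : Csum * eps <= gap / 4.
  apply: (@le_trans _ _ ((Csum + 1) * eps)); first by rewrite ler_pM2r// lerDl.
  have C1 : 0 < Csum + 1 by rewrite ltr_wpDl.
  have : eps <= gap / (4 * (Csum + 1)) by rewrite ge_min lexx.
  by rewrite invfM mulrA ler_pdivlMr// mulrC.
have e2 : eta * (Mv + 1) = gap / 4.
  by rewrite /eta; field; rewrite gt_eqF// ltr_wpDl.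
have e3 : (c x - c y) * v y <= eta * Mv.
  apply: le_trans (ler_norm _) _; rewrite normrM.
  by apply: ler_pM => //; exact: ltW.
have e4 : f y - f x <= eta by rewrite (le_trans (ler_norm _))// distrC ltW.
have e5 : c x * (u x - v y) <= S * (u x - v y).
  by rewrite ler_wpM2r ?cS// (le_trans (ltW M0)).
have e6 : gap <= (u x - v y) * (Csum * b - S) by rewrite ler_pM2r// subr_gt0.
by move: e1 e2 e3 e4 e5 e6 suE svE diff gap0; rewrite /delta; nra.
Qed.
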